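(* A sequence $\tau=(\tau_n)_{n=0}^\infty\in\mathbb{C}^\infty$ is an analytic moment functional on $(l_{\mathrm{fin}},\ast)$, i.e. there exists a measure $\mu\in\mathcal{M}_a(\mathbb{R})$ such that $$\tau_n=\int_{\mathbb{R}}x^n\,d\mu(x),\quad n\in\mathbb{N}_0,$$ if and only if $\tau$ is $\ast$-positive, i.e. $$\tau(f\ast\bar f)=\sum_{j,k=0}^\infty\tau_{j+k}f_j\bar f_k\ge0\quad\text{for all } f\in l_{\mathrm{fin}},$$ and $\tau\in l^2_-$. For an analytic moment functional $\tau$ on $(l_{\mathrm{fin}},\ast)$ the measure $\mu\in\mathcal{M}_a(\mathbb{R})$ in this representation is uniquely defined.
   Context: $\mathbb{N}_0=\{0,1,2,\dots\}$. $\mathbb{C}^\infty$ is the space of all complex sequences, $l_{\mathrm{fin}}$ its subspace of finitely supported sequences; $\tau\in\mathbb{C}^\infty$ acts on $l_{\mathrm{fin}}$ by $\tau(f)=\sum_n\tau_nf_n$; $\bar f=(\bar f_n)_n$. $\ast$ is the Cauchy product $(f\ast g)_n=\sum_{i+j=n}f_ig_j$ on $l_{\mathrm{fin}}$. $l^2_-$ is the set of $\xi\in\mathbb{C}^\infty$ for which there is $q\in\mathbb{N}$ with $\sum_{n=0}^\infty|\xi_n|^2(n!)^{-2}2^{-qn}<\infty$. $\mathcal{M}_a(\mathbb{R})$ is the set of non-negative finite Borel measures $\mu$ on $\mathbb{R}$ whose Laplace transform $l_\mu(\lambda)=\int_{\mathbb{R}}e^{x\lambda}\,d\mu(x)$ is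 well-defined in a neighborhood of $0\in\mathbb{C}$ and holomorphic at $0$. *)

(* Defs.v *)
From HB Require Import structures.
From mathcomp Require Import all_boot all_order all_algebra.
From mathcomp Require Import complex.
From mathcomp Require Import all_classical all_reals all_analysis.

Set Implicit Arguments.
Unset Strict Implicit.
Unset Printing Implicit Defensive.

Import Order.TTheory GRing.Theory Num.Theory.
Import numFieldNormedType.Exports.

Local Open Scope classical_set_scope.
Local Open Scope ring_scope.
Local Open Scope complex_scope.

(** Finitely supported complex sequences are represented by [{poly R[i]}]:
    [f`_n] is the n-th term, [f * g] is the Cauchy product, and
    [map_poly conjc f] is the termwise complex conjugate. *)

Definition pairing (R : realType) (tau : nat -> R[i]) (f : {poly R[i]}) : R[i] :=
  \sum_(n < size f) tau n * f`_n.

(** [0 <= z] in [R[i]] means that [z] is real and non-negative. *)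
Definition star_positive (R : realType) (tau : nat -> R[i]) : Prop :=
  forall f : {poly R[i]}, 0 <= pairing tau (f * map_poly conjc f).

Definition l2_minus (R : realType) (xi : nat -> R[i]) : Prop :=
  exists q : nat, (0 < q)%N /\
    (\sum_(0 <= n <oo)
       (ComplexField.Normc.normc (xi n) ^+ 2 * (n`!)%:R ^- 2 * 2 ^- (q * n)%N)%:E < +oo)%E.

Definition cexp (R : realType) (z : R[i]) : R[i] :=
  (expR (complex.Re z))%:C * (cos (complex.Im z) +i* sin (complex.Im z)).

Definition cintegrable (R : realType)
    (mu : {finite_measure set (measurableTypeR R) -> \bar R}) (f : R -> R[i]) : Prop :=
  mu.-integrable [set: measurableTypeR R] (fun x => (complex.Re (f x))%:E) /\
  mu.-integrable [set: measurableTypeR R] (fun x => (complex.Im (f x))%:E).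

Definition cintegral (R : realType)
    (mu : {finite_measure set (measurableTypeR R) -> \bar R}) (f : R -> R[i]) : R[i] :=
  (\int[mu]_(x in [set: measurableTypeR R]) complex.Re (f x)) +i*
  (\int[mu]_(x in [set: measurableTypeR R]) complex.Im (f x)).

Definition laplace (R : realType)
    (mu : {finite_measure set (measurableTypeR R) -> \bar R}) (lambda : R[i]) : R[i] :=
  cintegral mu (fun x => cexp (x%:C * lambda)).

(** [R[i]^o] is the complex line as a normed space over itself, so [derivable]
    in the direction [1] is complex differentiability. *)
Definition holomorphic_at (R : realType) (F : R[i] -> R[i]) (z0 : R[i]) : Prop :=
  \forall z \near (z0 : R[i]^o), derivable (F : R[i]^o -> R[i]^o) z 1.

(** The class M_a(R); the Lebesgue integral is total, hence the explicit
    integrability clause. *)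
Definition analytic_measure (R : realType)
    (mu : {finite_measure set (measurableTypeR R) -> \bar R}) : Prop :=
  (\forall lambda \near (0 : R[i]^o), cintegrable mu (fun x => cexp (x%:C * lambda))) /\
  holomorphic_at (laplace mu) 0.

Definition represents (R : realType)
    (mu : {finite_measure set (measurableTypeR R) -> \bar R}) (tau : nat -> R[i]) : Prop :=
  forall n : nat,
    mu.-integrable [set: measurableTypeR R] (fun x => (x ^+ n)%:E) /\
    tau n = (\int[mu]_(x in [set: measurableTypeR R]) (x ^+ n))%:C.

Definition analytic_moment_functional (R : realType) (tau : nat -> R[i]) : Prop :=
  exists mu : {finite_measure set (measurableTypeR R) -> \bar R},
    analytic_measure mu /\ represents mu tau.

Lemma pairing_widen (R : realType) (tau : nat -> R[i]) (f : {poly R[i]}) (N : nat) :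
  (size f <= N)%N -> pairing tau f = \sum_(n < N) tau n * f`_n.
Proof.
move=> fN; rewrite /pairing (big_ord_widen N (fun n => tau n * f`_n)) // big_mkcond /=.
apply: eq_bigr => n _; case: ltnP => // fn.
by rewrite nth_default ?mulr0.
Qed.

Lemma pairing_star (R : realType) (tau : nat -> R[i]) (f : {poly R[i]}) :
  pairing tau (f * map_poly conjc f) =
  \sum_(j < size f) \sum_(k < size f) tau (j + k)%N * f`_j * conjc f`_k.
Proof.
have pD : {morph pairing tau : p q / p + q >-> p + q}.
  move=> p q; have sl := leq_maxl (size p) (size q); have sr := leq_maxr (size p) (size q).
  rewrite (pairing_widen tau (size_polyD p q)) (pairing_widen tau sl) (pairing_widen tau sr).
  by rewrite -big_split; apply: eq_bigr => i _; rewrite coefD mulrDr.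
have p0 : pairing tau 0 = 0 by rewrite /pairing size_poly0 big_ord0.
have pX a n : pairing tau (a *: 'X^n) = tau n * a.
  have sX : (size (a *: 'X^n : {poly R[i]}) <= n.+1)%N.
    by rewrite (leq_trans (size_scale_leq _ _)) // size_polyXn.
  rewrite (pairing_widen tau sX) big_ord_recr /= big1 ?add0r => [|i _].
    by rewrite coefZ coefXn eqxx mulr1.
  by rewrite coefZ coefXn ltn_eqF // !mulr0.
have -> : f * map_poly conjc f =
    \sum_(j < size f) \sum_(k < size f) (f`_j * conjc f`_k) *: 'X^(j + k).
  rewrite -{1}[f]coefK poly_def /map_poly poly_def mulr_suml; apply: eq_bigr => j _.
  rewrite mulr_sumr; apply: eq_bigr => k _.
  by rewrite -scalerAl -scalerAr scalerA exprD.
rewrite (big_morph _ pD p0); apply: eq_bigr => j _.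
rewrite (big_morph _ pD p0); apply: eq_bigr => k _.
by rewrite pX mulrA.
Qed.

(* Main.v *)
(** Hamburger part: a *-positive [tau] is real, and since a polynomial that is
    nonnegative on the line is [f * conj f] for some complex [f], it defines a
    positive functional on real polynomials. M. Riesz' extension argument turns
    this into a monotone linear functional [Lam] on all polynomially bounded
    functions; [Lam] of the indicator of [x <= t], made right continuous, is a
    distribution function whose Stieltjes measure has the moments [tau], because
    [Lam] of a polynomial is squeezed between step functions with jumps at points
    of continuity.

    Growth part: [tau] lies in [l2_minus] iff [|tau n| <= C n! K^n], which by
    summing the series of [exp (r x) + exp (- r x)] is the integrability of
    [exp (r |x|)] for some [r > 0]; this in turn is the analyticity of the measure.

    Uniqueness: if two such measures have the same moments, expanding [sin] and
    [cos] in power series shows that they integrate every polynomial in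
    [sin (h (x - a))] alike when [|h| < r]. Iterating [t |-> (3 t - t^3) / 2], such
    polynomials converge to [sgn (sin (h (x - a)))], which tends to [sgn (x - a)]
    as [h] tends to 0. Hence both measures agree on half-lines. *)

Require Import Defs.
From HB Require Import structures.
From mathcomp Require Import all_boot all_order all_algebra.
From mathcomp Require Import complex ring lra zify.
From mathcomp Require Import all_classical all_reals all_analysis.
From mathcomp Require Import measurable_realfun.

Set Implicit Arguments.
Unset Strict Implicit.
Unset Printing Implicit Defensive.

Import Order.TTheory GRing.Theory Num.Theory.
Import numFieldNormedType.Exports.

Local Open Scope classical_set_scope.
Local Open Scope ring_scope.
Local Open Scope complex_scope.

(** * Polynomials that are nonnegative on the real line *)

(** Induction on the Horner form, splitting the increment of [p * 'X + c] as [(p.[x] - p.[y]) * x +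
    p.[y] * (x - y)]. The estimate serves both for limits at a point and for the oscillation of [p]
    on fine subdivisions. *)
Lemma poly_lipschitz (R : realFieldType) (p : {poly R}) (B : R) :
  exists2 K, 0 < K & forall x y, `|x| <= B -> `|y| <= B ->
    `|p.[x] - p.[y]| <= K * `|x - y|.
Proof.
elim/poly_ind: p => [|p c [K K0 lipK]].
  by exists 1 => // x y _ _; rewrite !horner0 subrr normr0 mul1r.
exists (K * `|B| + (`|p.[0]| + K * `|B|) + 1) => [|x y xB yB].
  by rewrite ltr_wpDl // ?addr_ge0 // ?mulr_ge0 // ltW.
rewrite !hornerMXaddC.
have -> : p.[x] * x + c - (p.[y] * y + c) = (p.[x] - p.[y]) * x + p.[y] * (x - y).
  by ring.
have B0 : `|0 : R| <= B by rewrite normr0 (le_trans _ xB).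
have xB' : `|x| <= `|B| by rewrite (le_trans xB) // ler_norm.
have yB' : `|y| <= `|B| by rewrite (le_trans yB) // ler_norm.
have py : `|p.[y]| <= `|p.[0]| + K * `|B|.
  rewrite -(subrK p.[0] p.[y]) addrC (le_trans (ler_normD _ _)) // lerD2l.
  by rewrite (le_trans (lipK _ _ yB B0)) // subr0 ler_wpM2l // ltW.
rewrite (le_trans (ler_normD _ _)) // !normrM.
rewrite !mulrDl -addrA lerD //.
  apply: le_trans (ler_wpM2r (normr_ge0 x) (lipK _ _ xB yB)) _.
  by rewrite mulrAC ler_wpM2r // ler_wpM2l // ltW.
rewrite -[leLHS]addr0 lerD // ?mul1r // -mulrDl.
by rewrite ler_wpM2r.
Qed.

(** Continuity of [p] at [a] along one ray; the sign of [s] selects the side. *)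
Lemma horner_ge0_approach (R : realFieldType) (p : {poly R}) (a s : R) :
  (forall t, 0 < t -> 0 <= p.[a + s * t]) -> 0 <= p.[a].
Proof.
move=> pge0; have [K K0 lipK] := poly_lipschitz p (`|a| + `|s|).
rewrite leNgt; apply/negP => pa0.
(* Small enough that [p] changes by at most [- p.[a] / 2] between [a] and [a + s * t], while
   [t <= 1] keeps that point in the ball where [K] is valid. The [+ 1] covers [s = 0]. *)
pose t := Num.min 1 (- p.[a] / (2 * K * (`|s| + 1))).
have s1 : 0 < `|s| + 1 by rewrite ltr_wpDl.
have Ks : 0 < 2 * K * (`|s| + 1) by rewrite !mulr_gt0.
have t0 : 0 < t by rewrite lt_min ltr01 divr_gt0 // oppr_gt0.
have t1 : t <= 1 by rewrite ge_min lexx.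
have tK : t <= - p.[a] / (2 * K * (`|s| + 1)) by rewrite ge_min lexx orbT.
have st : `|s * t| <= `|s| by rewrite normrM (gtr0_norm t0) ler_piMr.
have := pge0 _ t0; apply/negP; rewrite -ltNge.
have /lipK : `|a + s * t| <= `|a| + `|s| by rewrite (le_trans (ler_normD _ _)) // lerD2l.
move=> /(_ a); rewrite lerDl normr_ge0 => /(_ isT).
rewrite [a + _]addrC addrK => /ler_normlW H.
have : K * `|s * t| <= K * (`|s| + 1) * t.
  rewrite normrM (gtr0_norm t0) -mulrA ler_wpM2l ?(ltW K0) // ler_wpM2r ?(ltW t0) //.
  by rewrite lerDl.
have : K * (`|s| + 1) * t <= - p.[a] / 2.
  move: tK; rewrite ler_pdivlMr // => tK.
  by lra.
rewrite addrC in H *.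
move: H pa0; set pat := p.[_ + _]; set pa := p.[a]; set X := K * `|_|; set Y := K * _ * _.
lra.
Qed.

(** Strong induction on the size: a complex root [z] of [p] yields the real quadratic factor [d]
    with roots [z] and its conjugate, and the quotient is again nonnegative. The factor ['X - z%:P]
    then joins the [f] of the quotient. *)
Lemma nonneg_poly_sqr_norm (R : realType) (p : {poly R}) :
  (forall x, 0 <= p.[x]) ->
  exists f : {poly R[i]}, map_poly (real_complex R) p = f * map_poly (@conjc R) f.
Proof.
have [n] := ubnP (size p); elim: n p => // n IH p /ltnSE sp p_ge0.
have [p1 | p_gt1] := leqP (size p) 1.
  have pc := size1_polyC p1; exists (Num.sqrt p`_0)%:C%:P.
  have p00 : 0 <= p`_0 by rewrite -[p`_0]addr0 -horner_coef0 addr0.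
  rewrite {1}pc !map_polyC /= -polyCM; congr (_%:P).
  by simpc; rewrite -expr2 sqr_sqrtr.
have p0 : p != 0 by apply: contraTneq p_gt1 => ->; rewrite size_poly0.
have [z pz] : exists z : R[i], root (map_poly (real_complex R) p) z.
  by apply/closed_rootP; rewrite size_map_poly gtn_eqF.
pose d : {poly R} := ('X - (complex.Re z)%:P) ^+ 2 + ((complex.Im z) ^+ 2)%:P.
have sd : size d = 3.
  rewrite /d size_polyDl size_exp_XsubC // (leq_ltn_trans (size_polyC_leq1 _)) //.
have d0 : d != 0 by rewrite -size_poly_eq0 sd.
have zc : z^* = (complex.Re z) +i* - complex.Im z by case: (z).
have dC : map_poly (real_complex R) d = ('X - z%:P) * ('X - (z^*)%:P).
  have -> : ('X - z%:P) * ('X - (z^*)%:P) = 'X ^+ 2 - (z + z^*)%:P * 'X + (z * z^*)%:P.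
    rewrite polyCD polyCM; ring.
  have -> : d = 'X ^+ 2 - (complex.Re z + complex.Re z)%:P * 'X +
                (complex.Re z ^+ 2 + complex.Im z ^+ 2)%:P.
    rewrite /d !polyCD; ring.
  rewrite rmorphD rmorphB !rmorphM /= !map_polyX !map_polyC /= -expr2.
  rewrite -polyCM; congr (_ - _%:P * _ + _%:P);
    by case: (z) => a b; apply/eqP; rewrite eq_complex /=; apply/andP; split; apply/eqP; ring.
have dp : d %| p.
  (* A real root must be double, since the cofactor [q] has the sign of [x - Re z] on both sides and
     so vanishes there. A nonreal root comes with its distinct conjugate. *)
  have [b0|b0] := eqVneq (complex.Im z) 0.
    have pa : root p (complex.Re z).
      move: pz; have -> : z = (complex.Re z)%:C by case: (z) b0 => ? ? /= ->.
      by rewrite fmorph_root.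
    have /factor_theorem[q pq] := pa.
    suff : root q (complex.Re z).
      move=> /factor_theorem[r qr]; rewrite /d b0 expr0n addr0 pq qr -mulrA -expr2.
      exact: dvdp_mull.
    have q_sign (s t : R) : 0 <= (s * t) * q.[complex.Re z + s * t].
      have := p_ge0 (complex.Re z + s * t).
      by rewrite pq hornerM hornerXsubC [_ + s * t]addrC addrK mulrC.
    rewrite rootE eq_le; apply/andP; split.
      rewrite -oppr_ge0 -hornerN; apply: (@horner_ge0_approach _ _ _ (-1)) => t t0.
      have := q_sign (-1) t; rewrite hornerN mulN1r mulNr oppr_ge0.
      by rewrite pmulr_rle0 // oppr_ge0.
    apply: (@horner_ge0_approach _ _ _ 1) => t t0.
    by have := q_sign 1 t; rewrite mul1r pmulr_rge0.
  rewrite -(dvdp_map (real_complex R)) dC Gauss_dvdp.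
    rewrite !dvdp_XsubCl pz /=; move: pz; rewrite -complex_root_conj.
    have -> // : map_poly conjc (map_poly (real_complex R) p) = map_poly (real_complex R) p.
    by rewrite -map_poly_comp; apply: eq_map_poly => x /=; rewrite oppr0.
  rewrite coprimep_XsubC root_XsubC.
  suff : conjc z != z by [].
  apply: contra b0 => /eqP; rewrite zc.
  by case: (z) => a b [] /= /eqP; rewrite -subr_eq0 -opprD oppr_eq0 -mulr2n mulrn_eq0.
have pE : p = p %/ d * d by rewrite divpK.
have d_ge0 x : 0 <= d.[x] by rewrite !hornerE addr_ge0 // ?sqr_ge0.
have [||f qf] := IH (p %/ d).
- by rewrite size_divp // sd (leq_trans _ sp) // ltn_subrL (ltn_trans _ p_gt1).
(* [d] may vanish at [x], so positivity of the quotient is obtained along a ray that leaves [x] away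
   from [Re z], where [d] is strictly positive. *)
- move=> x; pose s : R := if complex.Re z <= x then 1 else -1.
  apply: (@horner_ge0_approach _ _ _ s) => t t0.
  rewrite -(@pmulr_lge0 _ d.[x + s * t]); first by rewrite -hornerM -pE.
  rewrite lt_neqAle d_ge0 andbT eq_sym !hornerE paddr_eq0 ?sqr_ge0 // negb_and.
  rewrite sqrf_eq0 /s; apply/orP; left.
  case: leP => ?; rewrite ?mul1r ?mulN1r; first by rewrite gt_eqF //; lra.
  by rewrite lt_eqF //; lra.
exists (f * ('X - z%:P)); rewrite pE rmorphM /= qf dC rmorphM /= rmorphB /= map_polyX map_polyC /=.
ring.
Qed.

(** * Extension of positive functionals *)

(** A partially defined linear functional is encoded by its graph, so that extension is inclusion
    and unions of chains are available. Single-valuedness is a consequence of positivity. *)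
Definition positive_graph (T : Type) (R : realType) (G : set ((T -> R) * R)) : Prop :=
  [/\ G (fun=> 0, 0),
      forall (g h : T -> R) (y z : R), G (g, y) -> G (h, z) ->
        G (fun x => g x + h x, y + z),
      forall (g : T -> R) (y c : R), G (g, y) -> G (fun x => c * g x, c * y) &
      forall (g : T -> R) (y : R), G (g, y) -> (forall x, 0 <= g x) -> 0 <= y].

Section PositiveGraph.
Context (T : Type) (R : realType).
Implicit Types (G H : set ((T -> R) * R)) (g h : T -> R) (y z c : R).

Lemma positive_graph_le G g h y z : positive_graph G -> G (g, y) -> G (h, z) ->
  (forall x, g x <= h x) -> y <= z.
Proof.
move=> [_ GD GZ Gpos] Gg Gh gh; rewrite -subr_ge0 -mulN1r.
apply: (Gpos _ _ (GD _ _ _ _ Gh (GZ _ _ (-1) Gg))) => x.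
by rewrite mulN1r subr_ge0.
Qed.

Lemma positive_graph_inj G g y z : positive_graph G -> G (g, y) -> G (g, z) -> y = z.
Proof.
move=> pG Gy Gz; apply/eqP; rewrite eq_le.
by rewrite !(positive_graph_le pG _ _ (fun x => lexx (g x))).
Qed.

(* [c] below is the supremum of the values at the elements of the domain that lie below [g]. *)
Lemma positive_graph_extend G g a b y z : positive_graph G ->
  G (a, y) -> G (b, z) -> (forall x, a x <= g x <= b x) ->
  exists H c, [/\ positive_graph H, G `<=` H & H (g, c)].
Proof.
move=> pG Ga Gb agb; have [G0 GD GZ Gpos] := pG.
pose S := [set v | exists2 h, G (h, v) & forall x, h x <= g x].
have S_ub h v : G (h, v) -> (forall x, g x <= h x) -> ubound S v.
  move=> Gh gh w [h' Gh' h'g]; apply: (positive_graph_le pG Gh' Gh) => x.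
  exact: le_trans (h'g x) (gh x).
have Ssup : has_sup S.
  split; first by exists y, a => // x; have /andP[] := agb x.
  by exists z; apply: (S_ub b) => // x; have /andP[] := agb x.
pose c := sup S.
have c_ge h v : G (h, v) -> (forall x, h x <= g x) -> v <= c.
  by move=> Gh hg; apply: sup_ubound => //; [case: Ssup | exists h].
have c_le h v : G (h, v) -> (forall x, g x <= h x) -> c <= v.
  by move=> Gh gh; apply: ge_sup (S_ub _ _ Gh gh); case: Ssup.
(* The span of [G] and the pair [(g, c)]. *)
pose H : set ((T -> R) * R) := [set u | exists h v s,
  [/\ G (h, v), u.1 = (fun x => h x + s * g x) & u.2 = v + s * c]].
exists H, c; split.
- split.
  + exists (fun=> 0), 0, 0; split => //=; last by rewrite mul0r addr0.
    by apply/funext => x; rewrite mul0r addr0.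
  + move=> g1 g2 y1 y2 [h1 [v1 [s1 [G1 /= -> ->]]]] [h2 [v2 [s2 [G2 /= -> ->]]]].
    exists (fun x => h1 x + h2 x), (v1 + v2), (s1 + s2); split => /=.
    * exact: GD.
    * by apply/funext => x; ring.
    * by ring.
  + move=> g1 y1 k [h1 [v1 [s1 [G1 /= -> ->]]]].
    exists (fun x => k * h1 x), (k * v1), (k * s1); split => /=.
    * exact: GZ.
    * by apply/funext => x; ring.
    * by ring.
  + move=> g1 y1 [h1 [v1 [s [G1 /= -> ->]]]] pos.
    (* Dividing by [|s|] places [g] below a function in the domain of [G] when [s] is negative and
       above one when [s] is positive; the matching bound on [c] applies. *)
    have [s0|s0|s0] := ltgtP s 0.
    * have sN0 : 0 < - s by rewrite oppr_gt0.
      have -> : v1 + s * c = - s * ((- s)^-1 * v1 - c).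
        by field; rewrite lt_eqF.
      rewrite mulr_ge0 ?(ltW sN0) // subr_ge0; apply: c_le (GZ _ _ _ G1) _ => x.
      by rewrite ler_pdivlMl // mulNr -subr_ge0 opprK.
    * have -> : v1 + s * c = s * (c - (- s^-1) * v1) by field; rewrite gt_eqF.
      rewrite mulr_ge0 ?(ltW s0) // subr_ge0; apply: c_ge (GZ _ _ _ G1) _ => x.
      by rewrite mulNr lerNl ler_pdivlMl // mulrN -subr_ge0 opprK.
    * by rewrite s0 mul0r addr0; apply: Gpos G1 _ => x; have := pos x; rewrite s0 mul0r addr0.
- by move=> [h v] Gh; exists h, v, 0; split => //=; [apply/funext => x|]; rewrite mul0r addr0.
- exists (fun=> 0), 0, 1; split => //=; last by rewrite mul1r add0r.
  by apply/funext => x; rewrite mul1r add0r.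
Qed.

(** Zorn's lemma gives a maximal positive graph. A function sandwiched between two members of its
    domain already lies in the domain, because [positive_graph_extend] would otherwise enlarge the
    graph. *)
Lemma riesz_extension G : positive_graph G ->
  exists H, [/\ positive_graph H, G `<=` H &
    forall g a b y z, H (a, y) -> H (b, z) -> (forall x, a x <= g x <= b x) ->
      exists c, H (g, c)].
Proof.
move=> pG.
(* [set0] is allowed so that the empty chain has an upper bound. *)
have [F FP tot|H [PH Hmax]] :=
  @Zorn_bigcup _ [set H | positive_graph H /\ G `<=` H \/ H = set0].
  have [[H0 FH0 H0n]|noF] := pselect (exists2 H, F H & H <> set0); last first.
    right; rewrite -subset0 => u [H FH Hu]; apply: noF; exists H => // H0.
    by rewrite H0 in Hu.
  have FG H : F H -> forall u, H u -> positive_graph H /\ G `<=` H.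
    by move=> /FP[] // -> u [].
  have [pH0 GH0] : positive_graph H0 /\ G `<=` H0 by have [|//] := FP _ FH0.
  left; split; last by move=> u /GH0; exists H0.
  split.
  - by exists H0 => //; case: pH0.
  - move=> g h y z [H1 F1 Hg] [H2 F2 Hh]; have [p1 _] := FG _ F1 _ Hg.
    have [p2 _] := FG _ F2 _ Hh; have [H12|H21] := tot _ _ F1 F2.
      by exists H2 => //; case: p2 => _ + _ _; apply => //; exact: H12.
    by exists H1 => //; case: p1 => _ + _ _; apply => //; exact: H21.
  - move=> g y c [H1 F1 Hg]; have [[_ _ + _] _] := FG _ F1 _ Hg.
    by exists H1 => //; auto.
  - by move=> g y [H1 F1 Hg]; have [[_ _ _ +] _] := FG _ F1 _ Hg; exact.
have G0 : G (fun=> 0, 0) by case: pG.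
have [pH GH] : positive_graph H /\ G `<=` H.
  case: PH => // H0; exfalso; apply: (Hmax G); last by left; split.
  by rewrite H0; split; [|move=> /(_ _ G0)].
exists H; split => // g a b y z Ha Hb agb.
have [K [c [pK HK Kg]]] := positive_graph_extend pH Ha Hb agb.
exists c; apply: contrapT => nHg; apply: (Hmax K).
  by split => // KH; apply: nHg; exact: KH.
by left; split => //; exact: subset_trans GH HK.
Qed.

End PositiveGraph.

(** * Stieltjes measures of monotone functions *)

Lemma lebesgue_stieltjes_itvoc (R : realType) (G : cumulative R R) (a b : R) : a <= b ->
  lebesgue_stieltjes_measure G `]a, b]%classic = (G b - G a)%:E.
Proof.
move=> ab; rewrite /lebesgue_stieltjes_measure /measure_extension/=.
by rewrite measurable_mu_extE/= ?wlength_itv_bnd//; exact: is_ocitv.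
Qed.

Section RightEnvelope.
Context (R : realType) (F : R -> R).
Context (F_mono : {homo F : x y / x <= y}) (F_ge0 : forall x, 0 <= F x).

(** This is the right limit [F(x+)] of the monotone [F]. *)
Definition right_envelope (x : R) : R := inf (F @` [set` `]x, +oo[]).

Let lbF x : has_lbound (F @` [set` `]x, +oo[]).
Proof. by exists 0 => _ [t _ <-]; exact: F_ge0. Qed.

Let infF x : has_inf (F @` [set` `]x, +oo[]).
Proof. by split => //; exists (F (x + 1)), (x + 1) => //=; rewrite in_itv/= ltrDl ltr01. Qed.

Lemma right_envelope_cvg x : F t @[t --> x^'+] --> right_envelope x.
Proof.
by apply: nondecreasing_at_right_cvgr => // s t _ _ st; exact: F_mono.
Qed.

Lemma right_envelope_ge x : F x <= right_envelope x.
Proof.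
apply: lb_le_inf; first by case: (infF x).
by move=> y [t /=]; rewrite in_itv/= andbT => /ltW xt <-; exact: F_mono.
Qed.

Lemma right_envelope_le x y : x < y -> right_envelope x <= F y.
Proof. by move=> xy; apply: ge_inf => //; exists y => //=; rewrite in_itv/= xy. Qed.

Lemma right_envelope_homo : {homo right_envelope : x y / x <= y}.
Proof.
move=> x y; rewrite le_eqVlt => /predU1P[-> //|xy].
exact: le_trans (right_envelope_le xy) (right_envelope_ge y).
Qed.

Lemma right_envelope_right_continuous : right_continuous right_envelope.
Proof.
move=> x; apply/cvgrPdist_lt => e e0.
have [y [s /=]] := inf_adherent e0 (infF x).
rewrite in_itv/= andbT -/(right_envelope x) => xs <- Fs.
near=> t; have xt : x < t by near: t; exact: nbhs_right_gt.
have ts : t < s by near: t; exact: nbhs_right_lt.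
rewrite distrC ger0_norm ?subr_ge0; last exact/right_envelope_homo/ltW.
by rewrite ltrBlDl (le_lt_trans (right_envelope_le ts)).
Unshelve. all: by end_near. Qed.

(** The discontinuities of a monotone function are countable, hence Lebesgue null, and cannot fill
    []u, v[]. At a continuity point the envelope equals the left limit, which is at most [F a]. *)
Lemma right_envelope_eq_dense u v : u < v ->
  exists2 a, u < a < v & right_envelope a = F a.
Proof.
move=> uv.
have [a [uav nda]] : exists a, a \in (`]u, v[) /\ ~ discontinuity F a.
  apply: contrapT => nex.
  have ndF : {in `[u, v] &, nondecreasing_fun F} by move=> s t _ _; exact: F_mono.
  have := countable_lebesgue_measure0 (discontinuity_countable ndF).
  have -> : [set x | x \in (`]u, v[) /\ discontinuity F x] = `]u, v[%classic.
    apply/seteqP; split => x /=; first by case.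
    by move=> xuv; split => //; apply: contrapT => nd; apply: nex; exists x.
  rewrite lebesgue_measure_itv /= lte_fin uv -EFinB => -[] /eqP.
  by rewrite subr_eq0 gt_eqF.
exists a; first by move: uav; rewrite in_itv.
have cr := right_envelope_cvg (x := a).
have cl : cvg (F t @[t --> a^'-]).
  apply: nondecreasing_at_left_is_cvgr.
    by apply: nearW => x s t _ _; exact: F_mono.
  apply: nearW => x; exists (F a) => _ [t /= + <-].
  by rewrite in_itv/= => /andP[_ /ltW]; exact: F_mono.
have El : lim (F t @[t --> a^'-]) = right_envelope a.
  apply: contrapT => ne; apply: nda; split => //; first by apply/cvg_ex; eexists; exact: cr.
  by rewrite (cvg_lim _ cr) //; exact/eqP.
apply/eqP; rewrite eq_le right_envelope_ge andbT -El.
apply: limr_le => //; near=> t; apply: F_mono; apply: ltW.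
by near: t; exact: nbhs_left_lt.
Unshelve. all: by end_near. Qed.

(** With [0 <= F <= m], every []-n, n]] has mass at most [m]; continuity from below makes the
    Stieltjes measure finite. *)
Lemma right_envelope_measure (m : R) : (forall x, F x <= m) ->
  exists mu : {finite_measure set (measurableTypeR R) -> \bar R},
    forall a b, a <= b -> mu `]a, b]%classic = (right_envelope b - right_envelope a)%:E.
Proof.
move=> F_le.
pose G : cumulative R R := HB.pack right_envelope
  (isCumulative.Build R _ R right_envelope right_envelope_homo right_envelope_right_continuous).
pose nu := lebesgue_stieltjes_measure G.
have nuE a b : a <= b -> nu `]a, b]%classic = (right_envelope b - right_envelope a)%:E.
  by move=> ab; rewrite /nu lebesgue_stieltjes_itvoc.
have nufin : fin_num_fun (nu : set (measurableTypeR R) -> \bar R).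
  apply: lty_fin_num_fun; apply: (@le_lt_trans _ _ m%:E); last by rewrite ltry.
  rewrite -(bigcup_itvT false false).
  pose I n : set R := `]- (n%:R), n%:R]%classic.
  have nuI : (nu \o I) n @[n --> \oo] --> nu (\bigcup_n I n).
    apply: nondecreasing_cvg_mu; rewrite /I//; first exact: bigcup_measurable.
    by move=> *; apply/subsetPset/subset_itv; rewrite leBSide/= ?lerN2 ler_nat.
  suff : (nu (\bigcup_n I n) <= m%:E)%E by [].
  rewrite -(cvg_lim _ nuI) //; apply: lime_le.
    by apply/cvg_ex; eexists; exact: nuI.
  apply: nearW => n /=; rewrite nuE ?ge0_cp // lee_fin.
  have : right_envelope n%:R <= m.
    by apply: le_trans (right_envelope_le (_ : n%:R < n.+1%:R)) (F_le _); rewrite ltr_nat.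
  have : 0 <= right_envelope (- n%:R) by exact: le_trans (F_ge0 _) (right_envelope_ge _).
  lra.
pose lsm : {measure set (measurableTypeR R) -> \bar R} := lebesgue_stieltjes_measure G.
pose mu : {finite_measure set (measurableTypeR R) -> \bar R} :=
  HB.pack (Measure.sort lsm) lsm
    (Measure_isFinite.Build _ (measurableTypeR R) R lsm nufin).
by exists mu => a b; exact: nuE.
Qed.

End RightEnvelope.

(** * The Hamburger moment problem *)

Section RealIntegral.
Context d (T : measurableType d) (R : realType) (mu : {measure set T -> \bar R}).
Implicit Types f g : T -> R.

Lemma integrable_le_norm f g : measurable_fun setT f -> (forall x, `|f x| <= g x) ->
  mu.-integrable setT (EFin \o g) -> mu.-integrable setT (EFin \o f).
Proof.
move=> mf fg; apply: le_integrable => //; first exact/measurable_EFinP.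
by move=> x _ /=; rewrite lee_fin (le_trans (fg x)) // ler_norm.
Qed.

Lemma Rintegral_dominated_cvg (f_ : (T -> R)^nat) f g :
  (forall n, measurable_fun setT (f_ n)) ->
  (forall x, f_ n x @[n --> \oo] --> f x) ->
  mu.-integrable setT (EFin \o g) ->
  (forall n x, `|f_ n x| <= g x) ->
  mu.-integrable setT (EFin \o f) /\
  \int[mu]_x f_ n x @[n --> \oo] --> \int[mu]_x f x.
Proof.
move=> mf_ cf ig fg.
have cfE x : setT x -> (f_ n x)%:E @[n --> \oo] --> (f x)%:E.
  by move=> _; apply: cvg_EFin; [exact: nearW | exact: cf].
have intf : mu.-integrable setT (EFin \o f).
  apply: (integrable_le_norm _ _ ig).
    by apply: measurable_fun_cvg => //; move=> x _; exact: cf.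
  move=> x; have : `|f_ n x| @[n --> \oo] --> `|f x| by apply: cvg_norm; exact: cf.
  by move=> /cvg_lim <- //; apply: limr_le; [apply: is_cvg_norm; apply/cvg_ex; exists (f x)
    | exact: nearW].
split => //; apply: fine_cvg; rewrite fineK ?integrable_fin_num //.
apply: (@dominated_cvg _ _ _ mu setT measurableT (fun n x => (f_ n x)%:E) _ (EFin \o g)) => //.
  by move=> n; exact/measurable_EFinP.
by move=> n x _; rewrite /= lee_fin.
Qed.

End RealIntegral.

(** Such a function lies between [- p] and [p], which is what the extension theorem requires of
    it. *)
Definition poly_bounded (R : realType) (g : R -> R) : Prop :=
  exists p : {poly R}, forall x, `|g x| <= p.[x].

Lemma poly_boundedD (R : realType) (g h : R -> R) :
  poly_bounded g -> poly_bounded h -> poly_bounded (fun x => g x + h x).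
Proof.
move=> [p gp] [q hq]; exists (p + q) => x.
by rewrite hornerD (le_trans (ler_normD _ _)) // lerD.
Qed.

Lemma poly_boundedM (R : realType) (g h : R -> R) :
  poly_bounded g -> poly_bounded h -> poly_bounded (fun x => g x * h x).
Proof.
move=> [p gp] [q hq]; exists (p * q) => x.
by rewrite hornerM normrM ler_pM.
Qed.

Lemma poly_bounded_cst (R : realType) (c : R) : poly_bounded (fun=> c).
Proof. by exists `|c|%:P => x; rewrite hornerC. Qed.

Lemma poly_bounded_horner (R : realType) (p : {poly R}) : poly_bounded (horner p).
Proof.
exists (1 + p ^+ 2) => x; rewrite !hornerE.
by rewrite ler_norml; apply/andP; split; nra.
Qed.

Lemma poly_bounded_bool (R : realType) (P : R -> bool) : poly_bounded (fun x => (P x)%:R).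
Proof. by exists 1 => x; rewrite hornerC; case: (P x); rewrite ?normr1 ?normr0. Qed.

Lemma positive_poly_functional_extension (R : realType) (L : {poly R} -> R) :
  (forall p q, L (p + q) = L p + L q) -> (forall c p, L (c *: p) = c * L p) ->
  (forall p, (forall x, 0 <= p.[x]) -> 0 <= L p) ->
  exists Lam : (R -> R) -> R,
  [/\ forall p, Lam (horner p) = L p,
      forall g h, poly_bounded g -> poly_bounded h ->
        Lam (fun x => g x + h x) = Lam g + Lam h,
      forall c g, poly_bounded g -> Lam (fun x => c * g x) = c * Lam g &
      forall g h, poly_bounded g -> poly_bounded h -> (forall x, g x <= h x) ->
        Lam g <= Lam h].
Proof.
move=> LD LZ Lpos.
pose G0 : set ((R -> R) * R) := [set u | exists p, u = (horner p, L p)].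
have pG0 : positive_graph G0.
  split.
  - exists 0; congr (_, _); first by apply/funext => x; rewrite horner0.
    by have := LZ 0 0; rewrite scale0r mul0r.
  - move=> _ _ _ _ [p [-> ->]] [q [-> ->]]; exists (p + q); rewrite LD; congr (_, _).
    by apply/funext => x; rewrite hornerD.
  - move=> _ _ c [p [-> ->]]; exists (c *: p); rewrite LZ; congr (_, _).
    by apply/funext => x; rewrite hornerZ.
  - by move=> _ _ [p [-> ->]]; exact: Lpos.
have [H [pH G0H Hext]] := riesz_extension pG0.
(* Outside the domain of [H] the default value 0 is taken; polynomially bounded functions all lie in
   the domain. *)
pose Lam g := xget 0 [set y | H (g, y)].
have HLam g : poly_bounded g -> H (g, Lam g).
  move=> [p gp]; have [c Hc] : exists c, H (g, c).
    apply: (Hext _ (horner (- p)) (horner p)); [by apply: G0H; exists (- p)| by apply: G0H; exists p|].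
    by move=> x; rewrite hornerN -ler_norml.
  exact: (@xgetPex _ 0 [set y | H (g, y)]) (ex_intro _ c Hc).
have HE g y : H (g, y) -> Lam g = y.
  move=> Hy; apply: (positive_graph_inj pH) (Hy).
  exact: (@xgetPex _ 0 [set y | H (g, y)]) (ex_intro _ y Hy).
have [_ HD HZ _] := pH.
exists Lam; split.
- by move=> p; apply: HE; apply: G0H; exists p.
- by move=> g h bg bh; apply: HE; apply: HD; exact: HLam.
- by move=> c g bg; apply: HE; apply: HZ; exact: HLam.
- by move=> g h bg bh gh; apply: (positive_graph_le pH) gh; exact: HLam.
Qed.

(** On bounded intervals, integrals of [p] are compared with [Lam] through fine subdivisions.
    Growing the interval gives first integrability, then that the integral of [p] is at most [L p];
    the same bound for [- p] gives equality. *)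
Lemma hamburger_measure (R : realType) (L : {poly R} -> R) :
  (forall p q, L (p + q) = L p + L q) -> (forall c p, L (c *: p) = c * L p) ->
  (forall p, (forall x, 0 <= p.[x]) -> 0 <= L p) ->
  exists mu : {finite_measure set (measurableTypeR R) -> \bar R},
    forall p : {poly R}, mu.-integrable [set: measurableTypeR R] (EFin \o horner p) /\
      L p = \int[mu]_x p.[x].
Proof.
move=> LD LZ Lpos.
have [Lam [LamL LamD LamZ LamLe]] := positive_poly_functional_extension LD LZ Lpos.
pose F t := Lam (fun x => (x <= t)%R%:R).
have bb P : poly_bounded (fun x : R => (P x : bool)%:R) by exact: poly_bounded_bool.
have bp p : poly_bounded (@horner R p) by exact: poly_bounded_horner.
have bc c : poly_bounded (fun _ : R => c) by exact: poly_bounded_cst.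
have Lam0 : Lam (fun=> 0) = 0.
  by have := LamZ 0 _ (bc 1); rewrite !mul0r.
have F_mono : {homo F : x y / x <= y}.
  move=> s t st; apply: LamLe => // x; rewrite ler_nat.
  by case: (leP x s) => // xs; rewrite (le_trans xs st).
have F_ge0 t : 0 <= F t by rewrite -Lam0; apply: LamLe.
have Lam1 : Lam (fun=> 1) = L 1.
  by rewrite -LamL; congr Lam; apply/funext => x; rewrite hornerC.
have F_le t : F t <= L 1.
  by rewrite -Lam1; apply: LamLe => // x; case: (x <= t); rewrite ?ler01.
have [mu muE] := right_envelope_measure F_mono F_ge0 F_le.
exists mu.
pose T := measurableTypeR R.
(* At such endpoints [mu] gives []u, v]] exactly the mass [F v - F u], which is [Lam] of the
   indicator [I u v]. *)
pose good a := right_envelope F a = F a.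
pose I (u v x : R) : R := (u < x <= v)%R%:R.
have IE u v : I u v = \1_(`]u, v]%classic : set R).
  apply/funext => x; rewrite indicE /I; congr (nat_of_bool _)%:R.
  by apply/idP/idP; rewrite inE /= in_itv.
have mI u v : measurable_fun [set: T] (I u v : T -> R).
  by rewrite IE; exact: measurable_indic.
have mp p : measurable_fun [set: T] (horner p : T -> R) by exact: measurable_poly.
have ipI p u v : mu.-integrable [set: T] (fun x : T => (p.[x] * I u v x)%:E).
  have [K K0 lipK] := poly_lipschitz p (`|u| + `|v|).
  apply: (@integrable_le_norm _ _ _ _ _ (cst (`|p.[0]| + K * (`|u| + `|v|)))).
  - exact: measurable_funM.
  - move=> x; rewrite /I; have [/andP[ux xv]|_] := boolP (u < x <= v); last first.
      by rewrite mulr0 normr0 addr_ge0 // mulr_ge0 ?(ltW K0) // addr_ge0.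
    rewrite mulr1 -[X in `|X|](subrK p.[0]) addrC (le_trans (ler_normD _ _)) // lerD2l.
    have xB : `|x| <= `|u| + `|v|.
      rewrite ler_norml; have := ler_norm v; have := ler_norm (- u); rewrite normrN.
      by have := normr_ge0 v; have := normr_ge0 u; lra.
    by rewrite (le_trans (lipK _ _ xB _)) ?normr0 ?addr_ge0 // subr0 ler_wpM2l // ltW.
  - exact: (@finite_measure_integrable_cst _ _ _ mu).
have iI u v : mu.-integrable [set: T] (EFin \o (I u v : T -> R)).
  have := ipI 1 u v; apply: eq_integrable => // x _ /=.
  by rewrite hornerC mul1r.
have LamI u v : u <= v -> good u -> good v -> \int[mu]_x I u v x = Lam (I u v).
  move=> uv gu gv.
  have -> : \int[mu]_x I u v x = fine (mu `]u, v]%classic).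
    by rewrite IE /Rintegral integral_indic // setIT.
  rewrite muE //= gu gv /F; apply/eqP; rewrite subr_eq -LamD; [|exact: bb|exact: bb].
  apply/eqP; congr Lam; apply/funext => x; rewrite /I -natrD; congr _%:R.
  have [xu|xu] := leP x u; first by rewrite (le_trans xu uv).
  by rewrite addn0.
have bI u v : poly_bounded (I u v) by exact: (bb (fun x => u < x <= v)).
have pbI (p : {poly R}) u v : poly_bounded (fun x => p.[x] * I u v x).
  exact: poly_boundedM (bp p) (bI u v).
have pbeI (p : {poly R}) e u v : poly_bounded (fun x => (p.[x] + e) * I u v x).
  exact: poly_boundedM (poly_boundedD (bp p) (bc e)) (bI u v).
(* On []u, v]] the polynomial is at most [c + e], and [c + e] is at most [p.[x] + 2 * e]; in
   between, [LamI] exchanges the integral with [Lam]. *)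
have block p u v (c e : R) : u <= v -> good u -> good v ->
    (forall x, u < x <= v -> `|p.[x] - c| <= e) ->
    \int[mu]_x (p.[x] * I u v x) <= Lam (fun x => (p.[x] + 2 * e) * I u v x).
  move=> uv gu gv pc.
  apply: (@le_trans _ _ (\int[mu]_x ((c + e) * I u v x))).
    apply: le_Rintegral => //; first exact: ipI.
      exact: (integrableZl _ (c + e) (iI u v)).
    move=> x _; rewrite /I; have [/pc|] := boolP (u < x <= v); last by rewrite !mulr0.
    by rewrite !mulr1 ler_norml => /andP[]; lra.
  rewrite RintegralZl // LamI // -LamZ; last exact: bb.
  apply: LamLe; [exact: poly_boundedM (bc _) (bI u v) | exact: pbeI |].
  move=> x; rewrite /I; have [/pc|] := boolP (u < x <= v); last by rewrite !mulr0.
  by rewrite !mulr1 ler_norml => /andP[]; lra.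
have chain p (N : nat) e : 0 < e -> exists u v, [/\ u <= - N%:R, N%:R <= v &
    \int[mu]_x (p.[x] * I u v x) <= Lam (fun x => (p.[x] + e) * I u v x)].
  move=> e0; have [K K0 lipK] := poly_lipschitz p (N%:R + 1).
  (* The mesh [h] is so small that [p] oscillates by at most [e / 2] over a length [2 * h], which
     bounds the gap between good points taken from two neighbouring cells. *)
  pose k := Num.bound (4 * K / e); pose h : R := k.+1%:R^-1.
  have h0 : 0 < h by rewrite invr_gt0 ltr0n.
  have Kh : K * (2 * h) <= e / 2.
    have : 4 * K / e < k.+1%:R.
      rewrite (lt_trans (archi_boundP _)) ?ltr_nat //.
      by rewrite divr_ge0 ?mulr_ge0 ?ltW.
    rewrite ltr_pdivrMr // -(ltr_pM2l h0) [X in _ < X]mulrA {2}/h mulVf ?pnatr_eq0 // mul1r.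
    lra.
  pose g i : R := - N%:R - 1 + i%:R * h.
  have gS i : g i.+1 = g i + h by rewrite /g -natr1; ring.
  have /choice[a aP] (i : nat) : exists a, g i < a < g i.+1 /\ good a.
    have [|a ga gooda] := right_envelope_eq_dense F_mono F_ge0 (_ : g i < g i.+1).
      by rewrite gS ltrDl.
    by exists a.
  (* The grid starts at [- N - 1] with [k.+1] cells per unit, so it reaches [N] after [2 N + 1]
     units. As [h <= 1], the points [a 0] and [a M] enclose [[-N, N]] and stay within [N + 1] of the
     origin. *)
  pose M := ((2 * N).+1 * k.+1)%N.
  have gM : g M = N%:R.
    rewrite /g /M natrM -mulrA mulfV ?pnatr_eq0 // -addn1 natrD natrM; ring.
  have h1 : h <= 1 by rewrite invf_le1 ?ltr0n // ler1n.
  have g_mono i j : (i <= j)%N -> g i <= g j.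
    by move=> ij; rewrite /g lerD2l ler_wpM2r ?(ltW h0) // ler_nat.
  have a_mono i j : (i < j)%N -> a i <= a j.
    move=> ij; have [/andP[_ ai] _] := aP i; have [/andP[aj _] _] := aP j.
    by rewrite (le_trans (ltW ai)) // (le_trans (g_mono _ _ ij)) // ltW.
  have a_bnd i : (i <= M)%N -> `|a i| <= N%:R + 1.
    move=> iM; have [/andP[ai1 ai2] _] := aP i.
    have := g_mono _ _ iM; rewrite gM => giM.
    have := g_mono _ _ (leq0n i); rewrite {1}/g mul0r addr0 => gi0.
    by rewrite gS in ai2; rewrite ler_norml; apply/andP; split; lra.
  suff claim i : (i <= M)%N -> \int[mu]_x (p.[x] * I (a 0%N) (a i) x) <=
      Lam (fun x => (p.[x] + e) * I (a 0%N) (a i) x).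
    exists (a 0%N), (a M); split; [| |exact: claim].
      have [/andP[_ +] _] := aP 0%N.
      by rewrite gS /g mul0r addr0; lra.
    by have [/andP[+ _] _] := aP M; rewrite gM => /ltW.
  elim: i => [_|i IH iM].
    have I0 : I (a 0%N) (a 0%N) = fun=> 0.
      by apply/funext => x; rewrite /I; case: ltP => //= ax; rewrite leNgt ax.
    rewrite I0; under eq_Rintegral do rewrite mulr0.
    have -> : (fun x => (p.[x] + e) * 0) = (fun=> 0) by apply/funext => x; rewrite mulr0.
    by rewrite Lam0 Rintegral_cst // mul0r.
  have ai0 : a 0%N <= a i by case: (i) => // j; exact: a_mono.
  have aiS : a i <= a i.+1 by exact: a_mono.
  have ID x : I (a 0%N) (a i.+1) x = I (a 0%N) (a i) x + I (a i) (a i.+1) x.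
    rewrite /I -natrD; congr _%:R; have [xi|xi] := leP x (a i).
      by rewrite (le_trans xi aiS) addn0.
    by rewrite (le_lt_trans ai0 xi).
  under eq_Rintegral do rewrite ID mulrDr.
  rewrite RintegralD //; [|exact: ipI|exact: ipI].
  have -> : (fun x => (p.[x] + e) * I (a 0%N) (a i.+1) x) =
      (fun x => (p.[x] + e) * I (a 0%N) (a i) x + (p.[x] + e) * I (a i) (a i.+1) x).
    by apply/funext => x; rewrite ID mulrDr.
  rewrite LamD //; apply: lerD; first exact/IH/ltnW.
  have -> : e = 2 * (e / 2) by field.
  apply: (block _ _ _ p.[a i.+1]) => //; [by case: (aP i)|by case: (aP i.+1)|].
  move=> x /andP[xi xi1].
  have ai := a_bnd _ (ltnW iM); have aS := a_bnd _ iM.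
  apply: le_trans (lipK _ _ _ aS) _.
    by move: ai aS; rewrite !ler_norml => /andP[? ?] /andP[? ?]; apply/andP; split; lra.
  apply: le_trans Kh; rewrite ler_wpM2l ?(ltW K0) //.
  have [/andP[l1 _] _] := aP i; have [/andP[_ l2] _] := aP i.+1.
  by rewrite !gS in l2; rewrite ler_norml; apply/andP; split; lra.
have mabs p : measurable_fun [set: T] (fun x : T => `|(p.[x])%:E|%E).
  apply: (@measurableT_comp _ _ _ _ _ _ abse) => //; exact/measurable_EFinP.
(* [chain] with error 1 bounds the integral over every []-n, n]] by [L p + L 1]; monotone
   convergence along these intervals gives integrability. *)
have int_pos p : (forall x, 0 <= p.[x]) -> mu.-integrable [set: T] (EFin \o horner p).
  move=> p0; apply/integrableP; split; first exact/measurable_EFinP.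
  apply: (@le_lt_trans _ _ (L p + L 1)%:E); last by rewrite ltry.
  rewrite -(bigcup_itvT false false).
  pose J n : set T := `]- (n%:R), n%:R]%classic.
  have : (\int[mu]_(x in J n) `|(p.[x])%:E|)%E @[n --> \oo] -->
      (\int[mu]_(x in \bigcup_n J n) `|(p.[x])%:E|)%E.
    apply: ge0_nondecreasing_set_cvg_integral => //.
    - by move=> *; apply/subsetPset/subset_itv; rewrite leBSide/= ?lerN2 ler_nat.
    - by move=> i; exact: measurable_itv.
    - by move=> i; apply: measurable_funTS; exact: mabs.
  move=> cv; suff : (\int[mu]_(x in \bigcup_n J n) `|(p.[x])%:E| <= (L p + L 1)%:E)%E by [].
  rewrite -(cvg_lim _ cv) //; apply: lime_le; first by apply/cvg_ex; eexists; exact: cv.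
  apply: nearW => n; have [u [v [un nv le]]] := chain p n 1 ltr01.
  apply: (@le_trans _ _ (\int[mu]_x (p.[x] * I u v x)%:E)%E).
    rewrite integral_mkcond; apply: ge0_le_integral => //.
    - by move=> x _; rewrite erestrict_ge0.
    - apply/(measurable_restrictT _ _).1; first exact: measurable_itv.
      by apply: measurable_funTS; exact: mabs.
    - by apply/measurable_EFinP; exact: measurable_funM.
    move=> x _; rewrite patchE; case: ifPn => [|_]; last by rewrite lee_fin mulr_ge0.
    rewrite inE /J /= in_itv /= => /andP[x1 x2].
    by rewrite /I (le_lt_trans un x1) (le_trans x2 nv) mulr1 lee_fin ger0_norm.
  rewrite -[leLHS]fineK; last exact/integrable_fin_num/ipI.
  rewrite lee_fin; apply: (le_trans le); rewrite -LD -LamL; apply: LamLe => //.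
  move=> x; rewrite !hornerE /I; case: (_ && _); rewrite ?mulr1 ?mulr0 //.
  by rewrite addr_ge0.
have int_all p : mu.-integrable [set: T] (EFin \o horner p).
  apply: (@integrable_le_norm _ T R mu (horner p) (horner (1 + p ^+ 2))) => //.
    by move=> x; rewrite !hornerE ler_norml; apply/andP; split; nra.
  by apply: int_pos => x; rewrite !hornerE; nra.
have int_le p : \int[mu]_x p.[x] <= L p.
  (* [|p| <= w / N] off [[-N, N]], so cutting [p] off there costs at most [L w / N]. *)
  pose w := (1 + p ^+ 2) * (2%:P + 'X ^+ 2).
  have /choice[uv uvP] (n : nat) : exists uv : R * R,
      [/\ uv.1 <= - n.+1%:R, n.+1%:R <= uv.2 &
    \int[mu]_x (p.[x] * I uv.1 uv.2 x) <=
      Lam (fun x => (p.[x] + n.+1%:R^-1) * I uv.1 uv.2 x)].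
    have [|u [v [? ? ?]]] := chain p n.+1 n.+1%:R^-1; first by rewrite invr_gt0 ltr0n.
    by exists (u, v).
  pose f_ n (x : T) := p.[x] * I (uv n).1 (uv n).2 x.
  have le n : \int[mu]_x f_ n x <= L p + n.+1%:R^-1 * (L 1 + L w).
    have [un vn] := uvP n; move/le_trans; apply.
    rewrite -LD -LZ -LD -LamL; apply: LamLe => // x.
    rewrite !hornerE; have n0 : 0 < n.+1%:R :> R by rewrite ltr0n.
    have ni : n.+1%:R * n.+1%:R^-1 = 1 :> R by rewrite mulfV ?gt_eqF.
    have i0 : 0 < n.+1%:R^-1 :> R by rewrite invr_gt0.
    set i := n.+1%:R^-1 in ni i0 *; set N := n.+1%:R in n0 ni un vn.
    have w0 : 0 <= (1 + p.[x] ^+ 2) * (2 + x ^+ 2) by nra.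
    rewrite /I; have [_|] := boolP (_ < _ <= _); first by rewrite mulr1; nra.
    rewrite mulr0 negb_and -leNgt -ltNge => xN.
    (* Outside []u, v]] one has [|x| >= N], and [|x| <= 2 + x ^+ 2] turns this into the factor of
       [w] that outweighs [N]. *)
    have Nx : N <= 2 + x ^+ 2.
      have : N <= `|x|.
        by case/orP: xN => [xu|xv]; [have := ler_norm (- x); rewrite normrN|have := ler_norm x]; lra.
      by have := real_normK (num_real x); set y := `|x|; nra.
    have pw : - p.[x] * N <= (1 + p.[x] ^+ 2) * (2 + x ^+ 2).
      have : - p.[x] <= 1 + p.[x] ^+ 2 by nra.
      nra.
    have : - p.[x] <= i * ((1 + p.[x] ^+ 2) * (2 + x ^+ 2)).
      by have := ler_wpM2l (ltW i0) pw; rewrite mulrCA [i * N]mulrC ni mulr1.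
    lra.
  have cvp (x : T) : f_ n x @[n --> \oo] --> p.[x].
    apply: (@cvg_near_cst _ _ _ _ _ _); near=> n.
    have xn : `|x| < n.+1%:R.
      near: n; exists (Num.bound `|x|) => // n /= xn.
      by rewrite (lt_le_trans (archi_boundP _)) // ler_nat leqW.
    have [un vn _] := uvP n; rewrite ltr_norml in xn; case/andP: xn => x1 x2.
    rewrite /f_ /I (le_lt_trans un x1) (le_trans (ltW x2) vn) mulr1 //.
  have f_m n : measurable_fun [set: T] (f_ n) by exact: measurable_funM.
  have f_le n x : `|f_ n x| <= (1 + p ^+ 2).[x].
    rewrite /f_ /I !hornerE; case: (_ && _); rewrite ?mulr1 ?mulr0 ?normr0; last by nra.
    by rewrite ler_norml; apply/andP; split; nra.
  have [_ cv] := Rintegral_dominated_cvg f_m cvp (int_all _) f_le.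
  rewrite -(cvg_lim _ cv) //.
  have cL : L p + n.+1%:R^-1 * (L 1 + L w) @[n --> \oo] --> L p.
    rewrite -[X in _ --> X]addr0; apply: cvgD; first exact: cvg_cst.
    rewrite -[X in _ --> X](mul0r (L 1 + L w)); apply: cvgMl.
    exact: cvg_harmonic.
  rewrite -[leRHS](cvg_lim _ cL) //; apply: ler_lim; last exact: nearW.
    by apply/cvg_ex; eexists; exact: cv.
  by apply/cvg_ex; eexists; exact: cL.
(* The bound for [- p] is the reverse inequality. *)
move=> p; split => //; apply/eqP; rewrite eq_le int_le andbT.
have := int_le (- p); rewrite -scaleN1r LZ mulN1r lerNr => /le_trans; apply.
under eq_Rintegral do rewrite hornerZ.
by rewrite RintegralZl // mulN1r opprK.
Unshelve. all: by end_near. Qed.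

(** * Measures with exponential moments are determined by their moments *)

Lemma exprn_le_expR (R : realType) (n : nat) (y : R) : 0 <= y -> y ^+ n <= n`!%:R * expR y.
Proof.
move=> y0; case: n => [|n]; first by rewrite mul1r expr0 -expR0 ler_expR.
have f0 : 0 < n.+1`!%:R :> R by rewrite ltr0n fact_gt0.
by rewrite mulrC -ler_pdivrMr // (le_trans _ (expR_ge1Dxn n y0)) // lerDr.
Qed.

Lemma series_exp_coeff_le (R : realType) (y : R) (n : nat) : 0 <= y ->
  series (exp_coeff y) n <= expR y.
Proof.
move=> y0; apply: nondecreasing_cvgn_le; last exact: is_cvg_series_exp_coeff.
by apply: nondecreasing_series => k _ _; exact: exp_coeff_ge0.
Qed.

Section ExponentialMoments.
Context (R : realType) (mu : {finite_measure set (measurableTypeR R) -> \bar R}) (r : R).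
Context (ir : mu.-integrable setT (fun x : measurableTypeR R => (expR (r * `|x|))%:E)).
Local Notation T := (measurableTypeR R).

Lemma measurable_exprn n : measurable_fun [set: T] (fun x : T => x ^+ n : R).
Proof. exact: measurable_funX. Qed.

Lemma measurable_expR_norm s : measurable_fun [set: T] (fun x : T => expR (s * `|x|)).
Proof.
by apply: measurableT_comp => //; exact: measurable_funM.
Qed.

(** The spare exponent [r - s] absorbs the power, since
    [((r - s) |x|)^n <= n! exp ((r - s) |x|)]. *)
Lemma integrable_exprn_expR n s : s < r ->
  mu.-integrable setT (fun x : T => (`|x| ^+ n * expR (s * `|x|))%:E).
Proof.
move=> sr; pose C : R := n`!%:R / (r - s) ^+ n.
have rs0 : 0 < r - s by rewrite subr_gt0.
apply: (@integrable_le_norm _ T R mu (fun x => `|x| ^+ n * expR (s * `|x|))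
  (fun x => C * expR (r * `|x|))).
- apply: measurable_funM; last exact: measurable_expR_norm.
  exact: measurable_funX.
- move=> x; rewrite ger0_norm; last by rewrite mulr_ge0 ?exprn_ge0 // expR_ge0.
  have -> : r * `|x| = (r - s) * `|x| + s * `|x| by ring.
  rewrite expRD mulrA ler_wpM2r ?expR_ge0 // /C mulrAC ler_pdivlMr ?exprn_gt0 //.
  by rewrite -exprMn mulrC exprn_le_expR // mulr_ge0 // ltW.
- exact: (integrableZl measurableT C ir).
Qed.

Lemma integrable_exprn n : 0 < r -> mu.-integrable setT (fun x : T => (x ^+ n)%:E).
Proof.
move=> r0; apply: (@integrable_le_norm _ T R mu (fun x => x ^+ n)
  (fun x => `|x| ^+ n * expR (0 * `|x|))); first exact: measurable_exprn.
- by move=> x; rewrite mul0r expR0 mulr1 normrX.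
- exact: integrable_exprn_expR.
Qed.

Lemma integrable_exprn_bounded n (f : T -> R) M : 0 < r -> measurable_fun setT f ->
  (forall x, `|f x| <= M) -> mu.-integrable setT (fun x : T => (x ^+ n * f x)%:E).
Proof.
move=> r0 mf fM.
apply: (@integrable_le_norm _ T R mu (fun x => x ^+ n * f x)
  (fun x => M * (`|x| ^+ n * expR (0 * `|x|)))).
- by apply: measurable_funM => //; exact: measurable_exprn.
- by move=> x; rewrite mul0r expR0 mulr1 normrM normrX mulrC ler_wpM2r // exprn_ge0.
- exact: (integrableZl measurableT M (integrable_exprn_expR n r0)).
Qed.

(* The partial sums of the series are dominated by [M |x|^n exp (|h| |x|)]. *)
Lemma cvg_moment_pseries (c : nat -> R) (g : R -> R) (h M : R) (f : T -> R) n :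
  (forall j, `|c j| <= j`!%:R^-1) ->
  (forall y, series (fun j => c j * y ^+ j) k @[k --> \oo] --> g y) ->
  `|h| < r -> measurable_fun setT f -> (forall x, `|f x| <= M) ->
  \sum_(0 <= j < k) (c j * h ^+ j * \int[mu]_x (x ^+ (n + j) * f x)) @[k --> \oo] -->
  \int[mu]_x (x ^+ n * (g (h * x) * f x)).
Proof.
move=> cj cg hr mf fM; have r0 : 0 < r by rewrite (le_lt_trans _ hr).
pose S k (x : T) : R := series (fun j => c j * (h * x) ^+ j) k.
pose f_ k (x : T) : R := x ^+ n * (S k x * f x).
have mS k : measurable_fun setT (S k).
  apply: measurable_sum => j; apply: measurable_funM => //.
  by apply: measurable_funX; exact: measurable_funM.
have mf_ k : measurable_fun setT (f_ k).
  by apply: measurable_funM; [exact: measurable_exprn|exact: measurable_funM].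
have if_ := integrableZl measurableT M (integrable_exprn_expR n hr).
have f_le k x : `|f_ k x| <= M * (`|x| ^+ n * expR (`|h| * `|x|)).
  rewrite /f_ !normrM normrX [M * _]mulrC -mulrA ler_wpM2l ?exprn_ge0 //.
  rewrite ler_pM // /S /series /=.
  apply: le_trans (series_exp_coeff_le k _); last by rewrite mulr_ge0.
  apply: le_trans (ler_norm_sum _ _ _) _; apply: ler_sum => j _.
  rewrite normrM normrX normrM /exp_coeff /= mulrC ler_wpM2l ?exprn_ge0 //.
have SE k : \int[mu]_x f_ k x =
    \sum_(0 <= j < k) (c j * h ^+ j * \int[mu]_x (x ^+ (n + j) * f x)).
  elim: k => [|k IH].
    rewrite big_geq //; under eq_Rintegral do rewrite /f_ /S /series /= big_geq // mul0r mulr0.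
    by rewrite Rintegral_cst // mul0r.
  have ifk := integrable_exprn_bounded (n + k) r0 mf fM.
  rewrite big_nat_recr //= -IH -RintegralZl // -RintegralD //.
  - apply: eq_Rintegral => x _; rewrite /f_ /S /series /= big_nat_recr //= exprMn exprD.
    ring.
  - exact: integrable_le_norm (mf_ k) (f_le k) if_.
  - exact: (integrableZl measurableT (c k * h ^+ k) ifk).
under eq_fun do rewrite -SE.
apply: (Rintegral_dominated_cvg mf_ _ if_ f_le).2 => x.
by apply: cvgMr; apply: cvgMl; exact: cg.
Qed.

End ExponentialMoments.

(** [b] and [k] stand for the parity factor and the exponent of the sign in a Taylor coefficient, so
    that one bound serves [sin] and [cos]. *)
Lemma normr_trig_coeff_le (R : realType) (b : bool) (k j : nat) :
  `|(b%:R : R) * (-1) ^+ k * j`!%:R^-1| <= j`!%:R^-1.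
Proof.
rewrite normrM normrM normrX normrN1 expr1n mulr1 ger0_norm ?ler0n //.
rewrite ger0_norm ?invr_ge0 // ler_piMl ?invr_ge0 //.
by case: b.
Qed.

(** The signed measures [f mu] and [f nu] have equal moments. Keeping all moments, and not only the
    total mass, lets the property survive multiplication by [sin (h x)] and [cos (h x)]. *)
Definition same_moments (R : realType)
    (mu nu : {finite_measure set (measurableTypeR R) -> \bar R}) (f : measurableTypeR R -> R) :=
  [/\ measurable_fun setT f, exists M, forall x, `|f x| <= M &
      forall n, \int[mu]_x (x ^+ n * f x) = \int[nu]_x (x ^+ n * f x)].

Section SameMoments.
Context (R : realType) (mu nu : {finite_measure set (measurableTypeR R) -> \bar R}) (r : R).
Context (imu : mu.-integrable setT (fun x : measurableTypeR R => (expR (r * `|x|))%:E)).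
Context (inu : nu.-integrable setT (fun x : measurableTypeR R => (expR (r * `|x|))%:E)).
Context (r0 : 0 < r).
Context (moments : forall n, \int[mu]_x (x ^+ n) = \int[nu]_x (x ^+ n)).
Local Notation T := (measurableTypeR R).
Local Notation same := (same_moments mu nu).

Lemma same_moments_cst c : same (fun=> c).
Proof.
split; [exact: measurable_cst|by exists `|c| | move=> n].
have im := integrable_exprn imu n r0; have in_ := integrable_exprn inu n r0.
by rewrite !RintegralZr // moments.
Qed.

Lemma same_momentsD f g a b : same f -> same g -> same (fun x => a * f x + b * g x).
Proof.
move=> [mf [M fM] ef] [mg [N gN] eg]; split.
- by apply: measurable_funD; exact: measurable_funM.
- exists (`|a| * M + `|b| * N) => x.
  by rewrite (le_trans (ler_normD _ _)) // !normrM lerD // ler_wpM2l.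
- move=> n.
  have E (m : {finite_measure set T -> \bar R}) :
      m.-integrable setT (fun x : T => (expR (r * `|x|))%:E) ->
      \int[m]_x (x ^+ n * (a * f x + b * g x)) =
      a * (\int[m]_x (x ^+ n * f x)) + b * \int[m]_x (x ^+ n * g x).
    move=> im; have i1 := integrable_exprn_bounded im n r0 mf fM.
    have i2 := integrable_exprn_bounded im n r0 mg gN.
    rewrite -RintegralZl // -RintegralZl // -RintegralD //.
    - by apply: eq_Rintegral => x _; ring.
    - exact: (integrableZl measurableT a i1).
    - exact: (integrableZl measurableT b i2).
  by rewrite (E _ imu) (E _ inu) ef eg.
Qed.

(** Expanding [g (h x)] turns each moment of the product into a series in the moments of [f], with
    the same terms for [mu] and [nu]. *)
Lemma same_moments_pseries (c : nat -> R) (g : R -> R) (h : R) f :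
  (forall j, `|c j| <= j`!%:R^-1) ->
  (forall y, series (fun j => c j * y ^+ j) k @[k --> \oo] --> g y) ->
  measurable_fun [set: T] g -> (forall y, `|g y| <= 1) ->
  `|h| < r -> same f -> same (fun x => g (h * x) * f x).
Proof.
move=> cj cg mg g1 hr [mf [M fM] ef]; split.
- apply: measurable_funM => //.
  by apply: (measurableT_comp mg); exact: measurable_funM.
- by exists M => x; rewrite normrM -[M]mul1r ler_pM.
- move=> n; have := cvg_moment_pseries (n := n) inu cj cg hr mf fM.
  have := cvg_moment_pseries (n := n) imu cj cg hr mf fM.
  under eq_fun do under eq_bigr do rewrite ef.
  by move=> /cvg_lim <- // /cvg_lim <-.
Qed.

Lemma same_moments_cos h f : `|h| < r -> same f -> same (fun x => cos (h * x) * f x).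
Proof.
apply: (same_moments_pseries (c := fun j => (~~ odd j)%:R * (-1) ^+ j./2 * j`!%:R^-1)).
- by move=> j; exact: normr_trig_coeff_le.
- move=> y; rewrite unlock; have := @is_cvg_series_cos_coeff R y; by rewrite cos_coeffE.
- by apply: continuous_measurable_fun; exact: continuous_cos.
- exact: cos_max.
Qed.

Lemma same_moments_sin h f : `|h| < r -> same f -> same (fun x => sin (h * x) * f x).
Proof.
apply: (same_moments_pseries (c := fun j => (odd j)%:R * (-1) ^+ j.-1./2 * j`!%:R^-1)).
- by move=> j; exact: normr_trig_coeff_le.
- move=> y; rewrite unlock; have := @is_cvg_series_sin_coeff R y; by rewrite sin_coeffE.
- by apply: continuous_measurable_fun; exact: continuous_sin.
- exact: sin_max.
Qed.

(** Horner induction: the addition formula splits the new factor [sin (h (x - a))] into [sin (h x)]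
    and [cos (h x)]. Factors enter one at a time, so [|h| < r] suffices for every degree. *)
Lemma same_moments_poly_sin (a h : R) (p : {poly R}) : `|h| < r ->
  same (fun x => p.[sin (h * (x - a))]).
Proof.
move=> hr; elim/poly_ind: p => [|p c IH].
  by under [X in same X]eq_fun do rewrite horner0; exact: same_moments_cst.
have -> : (fun x => (p * 'X + c%:P).[sin (h * (x - a))]) = fun x : T =>
    1 * (cos (h * a) * (sin (h * x) * p.[sin (h * (x - a))]) +
      (- sin (h * a)) * (cos (h * x) * p.[sin (h * (x - a))])) + c * 1.
  apply/funext => x; rewrite hornerMXaddC; set q := p.[_].
  rewrite mulrBr sinB; ring.
exact: (same_momentsD 1 c (same_momentsD (cos (h * a)) (- sin (h * a))
  (same_moments_sin hr IH) (same_moments_cos hr IH)) (same_moments_cst 1)).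
Qed.

End SameMoments.

(** * Polynomials converging to the sign function on [[-1, 1]] *)

Definition sign_poly (R : realType) (m : nat) : {poly R} :=
  iter m (fun p => (3 / 2) *: p - (1 / 2) *: p ^+ 3) 'X.

Lemma sign_polyS (R : realType) (m : nat) (y : R) :
  (sign_poly R m.+1).[y] = 3 / 2 * (sign_poly R m).[y] - 1 / 2 * (sign_poly R m).[y] ^+ 3.
Proof. by rewrite /= !hornerE. Qed.

Lemma sign_poly_norm_le1 (R : realType) (m : nat) (y : R) : `|y| <= 1 ->
  `|(sign_poly R m).[y]| <= 1.
Proof.
move=> y1; elim: m => [|m]; first by rewrite hornerX.
rewrite sign_polyS; set z := (sign_poly R m).[y]; rewrite !ler_norml => /andP[z1 z2].
(* With [z' = (3 z - z^3) / 2], the two products are [2 (1 - z')] and [2 (1 + z')]. *)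
have h1 : 0 <= (1 - z) ^+ 2 * (2 + z) by rewrite mulr_ge0 ?sqr_ge0 //; lra.
have h2 : 0 <= (1 + z) ^+ 2 * (2 - z) by rewrite mulr_ge0 ?sqr_ge0 //; lra.
by apply/andP; split; lra.
Qed.

Lemma sign_polyN (R : realType) (m : nat) (y : R) :
  (sign_poly R m).[- y] = - (sign_poly R m).[y].
Proof. by elim: m => [|m IH]; rewrite ?hornerX // !sign_polyS IH; ring. Qed.

(** For [z' = (3 z - z^3) / 2] one has [1 - z' = (1 - z) (1 - (z + z^2) / 2)]. The bound [y <= z],
    preserved because [z <= z'] on [[0, 1]], makes the last factor at most [1 - y / 2], whence
    geometric convergence. *)
Lemma sign_poly_pos (R : realType) (m : nat) (y : R) : 0 < y <= 1 ->
  y <= (sign_poly R m).[y] /\ 1 - (1 - y / 2) ^+ m <= (sign_poly R m).[y].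
Proof.
move=> /andP[y0 y1]; elim: m => [|m [IH1 IH2]].
  by rewrite hornerX expr0; split => //; lra.
have : `|(sign_poly R m).[y]| <= 1 by rewrite sign_poly_norm_le1 // gtr0_norm.
rewrite ler_norml sign_polyS [(1 - y / 2) ^+ m.+1]exprSr => /andP[_]; move: IH1 IH2.
set z := (sign_poly R m).[y]; set t := (1 - y / 2) ^+ m => yz tz z1.
have zz : 0 <= z * (1 - z) * (1 + z) by rewrite !mulr_ge0 //; lra.
split; first lra.
have H1 : (1 - z) * (1 - y / 2) <= t * (1 - y / 2) by rewrite ler_wpM2r //; lra.
have H2 : 0 <= (1 - z) * (z + z ^+ 2 - y).
  by rewrite mulr_ge0 //; [lra|have := sqr_ge0 z; lra].
lra.
Qed.

Lemma sign_poly_cvg (R : realType) (y : R) : `|y| <= 1 ->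
  (sign_poly R m).[y] @[m --> \oo] --> Num.sg y.
Proof.
have pos z : 0 < z <= 1 -> (sign_poly R m).[z] @[m --> \oo] --> (1 : R).
  move=> z01; apply: (@squeeze_cvgr _ _ _ _ (fun m => 1 - (1 - z / 2) ^+ m) (fun=> 1)).
  - near=> m; have [_ ->] := sign_poly_pos m z01 => /=.
    have /andP[z0 z1] := z01.
    have := @sign_poly_norm_le1 R m z; rewrite gtr0_norm // => /(_ z1).
    by rewrite ler_norml => /andP[].
  - rewrite -[X in _ --> X]subr0; apply: cvgB; first exact: cvg_cst.
    apply: cvg_expr; have /andP[z0 z1] := z01.
    by rewrite gtr0_norm; lra.
  - exact: cvg_cst.
move=> y1; have [y0|y0|->] := ltgtP y 0.
- have -> : (fun m => (sign_poly R m).[y]) = (fun m => - (sign_poly R m).[- y]).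
    by apply/funext => m; rewrite sign_polyN opprK.
  by rewrite ltr0_sg //; apply: cvgN; apply: pos; rewrite oppr_gt0 y0 -(ltr0_norm y0).
- by rewrite gtr0_sg //; apply: pos; rewrite y0 -(gtr0_norm y0).
- have -> : (fun m => (sign_poly R m).[0]) = (fun=> 0).
    apply/funext => m; have := sign_polyN m (0 : R); rewrite oppr0; lra.
  by rewrite sgr0; exact: cvg_cst.
Unshelve. all: by end_near. Qed.

Lemma measurable_sgr (R : realType) : measurable_fun [set: R] (@Num.sg R).
Proof.
have -> : @Num.sg R = fun x => \1_(`]0, +oo[%classic : set R) x - \1_(`]-oo, 0[%classic : set R) x.
  apply/funext => x; rewrite !indicE.
  have [x0|x0|->] := ltgtP x 0.
  - rewrite ltr0_sg // memNset /= ?in_itv /= ?andbT ?ltNge ?(ltW x0) //.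
    by rewrite mem_set /= ?in_itv //= sub0r.
  - rewrite gtr0_sg // mem_set /= ?in_itv /= ?andbT // memNset /= ?in_itv /= ?ltNge ?(ltW x0) //.
    by rewrite subr0.
  - by rewrite sgr0 !memNset /= ?in_itv /= ?ltxx // subrr.
by apply: measurable_funB; exact: measurable_indic.
Qed.

(** * Equality of the measures on half-lines and on Borel sets *)

Section MeasureOfMoments.
Context (R : realType) (mu nu : {finite_measure set (measurableTypeR R) -> \bar R}) (r : R).
Context (imu : mu.-integrable setT (fun x : measurableTypeR R => (expR (r * `|x|))%:E)).
Context (inu : nu.-integrable setT (fun x : measurableTypeR R => (expR (r * `|x|))%:E)).
Context (r0 : 0 < r).
Context (moments : forall n, \int[mu]_x (x ^+ n) = \int[nu]_x (x ^+ n)).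
Local Notation T := (measurableTypeR R).

Lemma eq_Rintegral_dominated_cvg (f_ : nat -> T -> R) (f : T -> R) (M : R) :
  (forall n, measurable_fun setT (f_ n)) ->
  (forall x, f_ n x @[n --> \oo] --> f x) -> (forall n x, `|f_ n x| <= M) ->
  (forall n, \int[mu]_x f_ n x = \int[nu]_x f_ n x) ->
  \int[mu]_x f x = \int[nu]_x f x.
Proof.
move=> mf_ cf fM ef.
have iM (m : {finite_measure set T -> \bar R}) : m.-integrable setT (EFin \o cst M).
  exact: (@finite_measure_integrable_cst _ _ _ m).
have [_ c1] := Rintegral_dominated_cvg mf_ cf (iM mu) fM.
have [_ c2] := Rintegral_dominated_cvg mf_ cf (iM nu) fM.
have efun : (fun n => \int[nu]_x f_ n x) = (fun n => \int[mu]_x f_ n x).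
  by apply/funext => n; rewrite ef.
by rewrite efun in c2; exact: (cvg_unique _ c1 c2).
Qed.

Lemma measurable_sin_affine (a h : R) :
  measurable_fun [set: T] (fun x : T => sin (h * (x - a)) : R).
Proof.
apply: (measurableT_comp (continuous_measurable_fun (@continuous_sin R))).
by apply: measurable_funM => //; exact: measurable_funB.
Qed.

Lemma eq_integral_sg_sin (a h : R) : `|h| < r ->
  \int[mu]_x Num.sg (sin (h * (x - a))) = \int[nu]_x Num.sg (sin (h * (x - a))).
Proof.
move=> hr; apply: (@eq_Rintegral_dominated_cvg
  (fun m x => (sign_poly R m).[sin (h * (x - a))]) _ 1).
- by move=> m; have [] := same_moments_poly_sin imu inu r0 moments a (sign_poly R m) hr.
- by move=> x; apply: sign_poly_cvg; exact: sin_max.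
- by move=> m x; apply: sign_poly_norm_le1; exact: sin_max.
- move=> m; have [_ _ /(_ 0%N)] := same_moments_poly_sin imu inu r0 moments a (sign_poly R m) hr.
  under eq_Rintegral do rewrite expr0 mul1r.
  by under [RHS]eq_Rintegral do rewrite expr0 mul1r.
Qed.

(* The square waves [sgr (sin (h (x - a)))] converge to [sgr (x - a)] as [h] tends to 0. *)
Lemma eq_integral_sg (a : R) :
  \int[mu]_x Num.sg (x - a : R) = \int[nu]_x Num.sg (x - a : R).
Proof.
(* The offset 2 makes [h n < r] strict already at [n = 0]. *)
pose h n : R := r / n.+2%:R.
have h0 n : 0 < h n by rewrite divr_gt0 // ltr0n.
apply: (@eq_Rintegral_dominated_cvg (fun n x => Num.sg (sin (h n * (x - a)))) _ 1).
- move=> n; apply: (measurableT_comp (@measurable_sgr R)); exact: measurable_sin_affine.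
- move=> x; apply: cvg_near_cst; near=> n.
  (* The bound 2 is chosen because [sin] is positive on []0, 2[]. *)
  have small : `|h n * (x - a)| < 2.
    rewrite normrM (gtr0_norm (h0 n)) /h mulrAC ltr_pdivrMr ?ltr0n //.
    near: n; exists (Num.bound (r * `|x - a|)) => // n /= bn.
    rewrite (lt_le_trans (archi_boundP _)) ?mulr_ge0 // ?(ltW r0) //.
    rewrite (@le_trans _ _ n%:R) ?ler_nat //.
    by rewrite -natrM ler_nat; lia.
  have sinpos y : 0 < y -> `|h n * y| < 2 -> 0 < sin (h n * y).
    move=> y0; rewrite gtr0_norm ?mulr_gt0 // => yn.
    by apply: sin2_gt0; rewrite mulr_gt0.
  have [xa|xa|xa] := ltgtP (x - a) 0.
  - have s0 : sin (h n * (x - a)) < 0.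
      by rewrite -oppr_gt0 -sinN -mulrN sinpos ?oppr_gt0 // mulrN normrN.
    by rewrite (ltr0_sg s0) (ltr0_sg xa).
  - by rewrite (gtr0_sg xa) (gtr0_sg (sinpos _ xa small)).
  - by rewrite xa mulr0 sin0.
- by move=> n x; case: sgrP => _; rewrite ?normr0 ?normrN ?normr1 ?ler01.
- move=> n; apply: eq_integral_sg_sin; rewrite gtr0_norm // /h ltr_pdivrMr ?ltr0n //.
  by rewrite ltr_pMr // ltr1n.
Unshelve. all: by end_near. Qed.

(** The jump is moved to [a + 1 / (n + 1)] so that the limit at [x = a] is -1 and not 0: an atom at
    [a] is counted in the closed ray. The limit is one minus twice the indicator of the ray, and the
    total masses agree as moments of order 0. *)
Lemma eq_measure_ray (a : R) : mu `]-oo, a]%classic = nu `]-oo, a]%classic.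
Proof.
have E : \int[mu]_x (1 - 2 * \1_(`]-oo, a]%classic : set T) x) =
    \int[nu]_x (1 - 2 * \1_(`]-oo, a]%classic : set T) x).
  apply: (@eq_Rintegral_dominated_cvg (fun n x => Num.sg (x - (a + n.+1%:R^-1))) _ 1).
  - by move=> n; apply: (measurableT_comp (@measurable_sgr R)); exact: measurable_funB.
  - move=> x; have [xa|xa] := leP x a; apply: cvg_near_cst; near=> n; rewrite indicE.
      rewrite mem_set /= ?in_itv //= ltr0_sg; first by ring.
      by rewrite subr_lt0 (le_lt_trans xa) // ltrDl invr_gt0 ltr0n.
    rewrite memNset /= ?in_itv /= ?leNgt ?xa //= gtr0_sg; first by ring.
    rewrite subr_gt0 -ltrBrDl; near: n.
    by apply: (cvgr_lt (0 : R)); [exact: cvg_harmonic | rewrite subr_gt0].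
  - by move=> n x; case: sgrP => _; rewrite ?normr0 ?normrN ?normr1 ?ler01.
  - by move=> n; exact: eq_integral_sg.
have E1 : \int[mu]_x 1 = \int[nu]_x (1 : R).
  have := moments 0; under eq_Rintegral do rewrite expr0.
  by under [RHS]eq_Rintegral do rewrite expr0.
have EB (m : {finite_measure set T -> \bar R}) :
    \int[m]_x (1 - 2 * \1_(`]-oo, a]%classic : set T) x) =
    \int[m]_x 1 - 2 * fine (m `]-oo, a]%classic).
  have i1 : m.-integrable setT (EFin \o (fun x : T => \1_(`]-oo, a]%classic : set T) x : R)).
    exact: (@integrable_indic _ _ _ m).
  have ic : m.-integrable setT (EFin \o (fun x : T => 1 : R)).
    exact: (@finite_measure_integrable_cst _ _ _ m).
  rewrite RintegralB //; last exact: (integrableZl measurableT (2 : R) i1).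
  by rewrite RintegralZl // /Rintegral integral_indic // setIT.
have : fine (mu `]-oo, a]%classic) = fine (nu `]-oo, a]%classic).
  by move: E; rewrite !EB E1; lra.
by move=> fE; rewrite -[LHS]fineK ?fin_num_measure // fE fineK // fin_num_measure.
Unshelve. all: by end_near. Qed.

(** Half-open intervals are stable under intersection and generate the Borel sets; each nonempty one
    is a difference of two rays. *)
Lemma finite_measure_determinacy (A : set T) : measurable A -> mu A = nu A.
Proof.
apply: (@measure_unique _ R T (R.-ocitv.-measurable) (fun n => `]- n%:R, n%:R]%classic)) => //.
- by move=> B C; exact: (@measurableI _ (ocitv_type R)).
- by move=> n; exact: is_ocitv.
- by rewrite (bigcup_itvT false false).
- move=> _ [[a b] _ <-] /=; have [ab|ba] := leP a b; last first.
    by rewrite set_itv_ge ?measure0 // bnd_simp -leNgt ltW.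
  have -> : `]a, b]%classic = `]-oo, b] `\` `]-oo, a] :> set R.
    by rewrite -[RHS]setCK setCD setCitvl setUC -[LHS]setCK setCitv.
  have sub : `]-oo, a]%classic `<=` (`]-oo, b]%classic : set R) by exact: subset_itvl.
  have fin (m : {finite_measure set T -> \bar R}) : (m `]-oo, b]%classic < +oo)%E.
    by rewrite -ge0_fin_numE // fin_num_measure.
  rewrite !measureD //; [|exact: fin|exact: fin].
  by rewrite (setIidr sub); congr (_ - _)%E; exact: eq_measure_ray.
- by move=> n; rewrite -ge0_fin_numE // fin_num_measure.
Qed.

End MeasureOfMoments.

(** * Growth of moments and exponential integrability *)

Lemma normc_real (R : rcfType) (x : R) : ComplexField.Normc.normc x%:C = `|x|.
Proof. by rewrite /= expr0n addr0 sqrtr_sqr. Qed.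

Lemma normc_nneg (R : rcfType) (z : R[i]) : 0 <= ComplexField.Normc.normc z.
Proof. by case: z => a b; rewrite sqrtr_ge0. Qed.

(** The radius of a ball in [R[i]^o] is itself an element of [R[i]]; its positivity forces it to be
    real. *)
Lemma near_complex0P (R : realType) (P : R[i] -> Prop) :
  (\forall z \near (0 : R[i]^o), P z) <->
  exists2 r : R, 0 < r & forall z, ComplexField.Normc.normc z < r -> P z.
Proof.
split.
  move=> /nbhs_ballP[e /= e0 Pe]; have eE : e = (complex.Re e)%:C.
    by move: e0; case: (e) => a b; rewrite ltcE /= => /andP[/eqP ->].
  exists (complex.Re e); first by rewrite -ltcR -eE.
  move=> z zr; apply: Pe; rewrite /ball /= sub0r normrN eE.
  by rewrite -ltcR in zr.
move=> [r r0 Pr]; apply/nbhs_ballP; exists (r%:C); first by rewrite /= ltcR.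
by move=> z; rewrite /ball /= sub0r normrN => zr; apply: Pr; rewrite -ltcR.
Qed.

Lemma l2_minus_of_bound (R : realType) (tau : nat -> R[i]) (C K : R) : 0 <= K ->
  (forall n, ComplexField.Normc.normc (tau n) <= C * n`!%:R * K ^+ n) -> l2_minus tau.
Proof.
move=> K0 tauK; pose b := Num.bound (K ^+ 2).
have Kb : K ^+ 2 <= 2 ^+ b.
  rewrite (le_trans (ltW (archi_boundP _))) ?sqr_ge0 // -natrX ler_nat.
  by rewrite ltnW // ltn_expl.
(* Since [K ^+ 2 <= 2 ^+ b], the extra 1 in the exponent leaves a factor [2^(-n)], and the terms are
   dominated by [C^2 2^(-n)]. *)
exists b.+1; split => //.
apply: (@le_lt_trans _ _ (\sum_(0 <= n <oo) ((2 * C ^+ 2) / (2 ^ (n + 1))%:R)%:E)%E).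
  apply: lee_nneseries => [n _ _|n _].
    by rewrite lee_fin !mulr_ge0 ?sqr_ge0 ?normc_nneg // ?invr_ge0 ?exprn_ge0 // ?ler0n.
  rewrite lee_fin; set N := ComplexField.Normc.normc (tau n).
  have f0 : 0 < n`!%:R :> R by rewrite ltr0n fact_gt0.
  have N2 : N ^+ 2 <= (C ^+ 2 * n`!%:R ^+ 2) * (K ^+ 2) ^+ n.
    have NK : N <= C * n`!%:R * K ^+ n := tauK n.
    by rewrite exprAC -!exprMn lerXn2r // ?nnegrE ?normc_nneg // (le_trans (normc_nneg _) NK).
  rewrite mulSn exprD exprM natrX exprD expr1 ler_pdivrMr ?mulr_gt0 ?exprn_gt0 //.
  rewrite ler_pdivrMr ?exprn_gt0 //.
  have -> : 2 * C ^+ 2 / (2 ^+ n * 2) * (2 ^+ n * (2 ^+ b) ^+ n) * n`!%:R ^+ 2 =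
      (C ^+ 2 * n`!%:R ^+ 2) * (2 ^+ b) ^+ n.
    by field; rewrite expf_neq0.
  apply: le_trans N2 _; apply: ler_wpM2l; first by rewrite mulr_ge0 ?sqr_ge0.
  by rewrite lerXn2r // nnegrE ?sqr_ge0 ?exprn_ge0.
by rewrite (cvg_lim _ (@cvg_geometric_eseries_half R (2 * C ^+ 2) 0)) // ltry.
Qed.

(** Each term is at most the sum [S] of the series. The inequalities [S <= (1 + S)^2] and
    [2^(q n) <= (2^(q n))^2] then allow square roots to be taken with [C = 1 + S] and
    [K = 2 ^+ q]. *)
Lemma l2_minus_bound (R : realType) (tau : nat -> R[i]) : l2_minus tau ->
  exists C K : R, [/\ 0 <= C, 0 < K &
    forall n, ComplexField.Normc.normc (tau n) <= C * n`!%:R * K ^+ n].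
Proof.
move=> [q [_ fin]].
pose u n : R := ComplexField.Normc.normc (tau n) ^+ 2 * n`!%:R ^- 2 * 2 ^- (q * n)%N.
have u0 n : 0 <= u n.
  by rewrite /u !mulr_ge0 ?sqr_ge0 ?normc_nneg // ?invr_ge0 ?exprn_ge0 // ?ler0n.
pose S := fine (\sum_(0 <= n <oo) (u n)%:E)%E.
have SE : (S%:E = \sum_(0 <= n <oo) (u n)%:E)%E.
  by rewrite fineK // ge0_fin_numE // nneseries_ge0 // => n _ _; rewrite lee_fin.
have uS n : u n <= S.
  rewrite -lee_fin SE; apply: (@le_trans _ _ (\sum_(0 <= i < n.+1) (u i)%:E)%E).
    by rewrite big_nat_recr //= leeDr // sume_ge0 // => i _; rewrite lee_fin.
  by apply: nneseries_lim_ge => i _ _; rewrite lee_fin.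
have S0 : 0 <= S := le_trans (u0 0%N) (uS 0%N).
exists (1 + S), (2 ^+ q); split; [by rewrite addr_ge0|by rewrite exprn_gt0|].
move=> n; have := uS n; rewrite /u.
set N := ComplexField.Normc.normc (tau n).
have N0 : 0 <= N by exact: normc_nneg.
have f0 : 0 < n`!%:R :> R by rewrite ltr0n fact_gt0.
have q0 : 1 <= 2 ^+ (q * n) :> R by rewrite exprn_ege1 // ler1n.
have q00 : 0 < 2 ^+ (q * n) :> R by rewrite exprn_gt0.
rewrite ler_pdivrMr // ler_pdivrMr ?exprn_gt0 // -exprM => H.
have T0 : 0 <= (1 + S) * n`!%:R * 2 ^+ (q * n).
  by rewrite !mulr_ge0 ?addr_ge0 ?ler0n // ltW.
rewrite -(@ler_pXn2r _ 2) ?nnegrE //.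
apply: (le_trans H); rewrite !exprMn mulrAC ler_wpM2r ?sqr_ge0 // ler_pM //.
  by have := sqr_ge0 S; lra.
by rewrite expr2 ler_peMl // ltW.
Qed.

Lemma Rintegral_sum_exprn (R : realType)
    (mu : {finite_measure set (measurableTypeR R) -> \bar R}) (c : nat -> R) (N : nat) :
  (forall n, mu.-integrable setT (fun x : measurableTypeR R => (x ^+ n)%:E)) ->
  mu.-integrable setT
    (fun x : measurableTypeR R => (\sum_(0 <= n < N) c n * x ^+ n)%:E) /\
  \int[mu]_x (\sum_(0 <= n < N) c n * x ^+ n) = \sum_(0 <= n < N) c n * \int[mu]_x (x ^+ n).
Proof.
move=> ix; pose T := measurableTypeR R.
pose g N (x : T) : R := \sum_(0 <= n < N) c n * x ^+ n.
suff : mu.-integrable setT (EFin \o g N) /\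
  \int[mu]_x g N x = \sum_(0 <= n < N) c n * \int[mu]_x (x ^+ n) by [].
elim: N => [|N [IH1 IH2]].
  have -> : g 0%N = cst 0 by apply/funext => x; rewrite /= /g big_geq.
  split; first exact: (@finite_measure_integrable_cst _ _ _ mu).
  by rewrite Rintegral_cst // mul0r big_geq.
have iN : mu.-integrable setT (fun x : T => (c N * x ^+ N)%:E).
  exact: (integrableZl measurableT (c N) (ix N)).
have -> : g N.+1 = fun x => g N x + c N * x ^+ N.
  by apply/funext => x; rewrite /g big_nat_recr.
split; first exact: (integrableD measurableT IH1 iN).
rewrite RintegralD // IH2 big_nat_recr //= RintegralZl //; exact: ix.
Qed.

(** The partial sums [g N] of [exp (r x) + exp (- r x)] are nonnegative and increasing and their
    integrals are bounded through the moments, so monotone convergence applies. *)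
Lemma integrable_expR_of_moments (R : realType)
    (mu : {finite_measure set (measurableTypeR R) -> \bar R}) (C K : R) : 0 <= C -> 0 < K ->
  (forall n, mu.-integrable setT (fun x : measurableTypeR R => (x ^+ n)%:E)) ->
  (forall n, \int[mu]_x (x ^+ n) <= C * n`!%:R * K ^+ n) ->
  exists2 r : R, 0 < r &
    mu.-integrable setT (fun x : measurableTypeR R => (expR (r * `|x|))%:E).
Proof.
move=> C0 K0 ix xK; pose T := measurableTypeR R.
(* Then [r * K = 1 / 2], and the integrals of the [g N] are at most
   [2 C (1 + 1/2 + 1/4 + ...) = 4 C]. *)
pose r := (2 * K)^-1; have r0 : 0 < r by rewrite invr_gt0 mulr_gt0.
exists r => //.
(* The factor [1 + (-1) ^+ n] removes the odd powers, so every term is nonnegative on the whole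
   line. *)
pose c n : R := (1 + (-1) ^+ n) * (r ^+ n / n`!%:R).
have c0 n : 0 <= c n.
  rewrite mulr_ge0 //; last by rewrite divr_ge0 ?ler0n // exprn_ge0 // ltW.
  by rewrite -signr_odd; case: (odd n); rewrite ?expr1 ?expr0 ?subrr ?addr_ge0.
have t0 n (x : R) : 0 <= c n * x ^+ n.
  have [nodd|neven] := boolP (odd n).
    by rewrite /c -signr_odd nodd expr1 subrr !mul0r.
  by rewrite mulr_ge0 // exprn_even_ge0.
pose g N (x : T) : R := \sum_(0 <= n < N) c n * x ^+ n.
have gE N x : g N x = series (exp_coeff (r * x)) N + series (exp_coeff (- (r * x))) N.
  rewrite /g /series /= -big_split /=; apply: eq_bigr => n _.
  rewrite /exp_coeff /= /c [(- _) ^+ n in RHS]exprNn !exprMn; ring.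
have mg N : measurable_fun setT (g N).
  apply: measurable_sum => n; apply: measurable_funM => //; exact: measurable_funX.
have ig N : mu.-integrable setT (EFin \o g N) /\ \int[mu]_x g N x <= 4 * C.
  suff [H1 ->] : mu.-integrable setT (EFin \o g N) /\
      \int[mu]_x g N x = \sum_(0 <= n < N) c n * \int[mu]_x (x ^+ n).
    split => //; apply: (@le_trans _ _ (\sum_(0 <= n < N) (2 * C) * 2^-1 ^+ n)).
      apply: ler_sum => n _; apply: le_trans (ler_wpM2l (c0 n) (xK n)) _.
      rewrite /c; have n0 : n`!%:R != 0 :> R by rewrite pnatr_eq0 -lt0n fact_gt0.
      have -> : (1 + (-1) ^+ n) * (r ^+ n / n`!%:R) * (C * n`!%:R * K ^+ n) =
          (1 + (-1) ^+ n) * C * (r * K) ^+ n by rewrite exprMn; field.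
      have -> : r * K = 2^-1 by rewrite /r; field; rewrite gt_eqF.
      rewrite ler_wpM2r ?exprn_ge0 ?invr_ge0 // ler_wpM2r //.
      by rewrite -signr_odd; case: (odd n); rewrite ?expr1 ?expr0; lra.
    rewrite -mulr_sumr.
    have -> : \sum_(0 <= n < N) 2^-1 ^+ n = 2 * (1 - 2^-1 ^+ N) :> R.
      elim: (N) => [|m IH]; first by rewrite big_geq // expr0 subrr mulr0.
      by rewrite big_nat_recr //= IH exprSr; field.
    have : 0 <= 2^-1 ^+ N :> R by rewrite exprn_ge0 // invr_ge0.
    by nra.
  exact: Rintegral_sum_exprn.
pose h (x : T) : R := expR (r * x) + expR (- (r * x)).
have g_cvg x : (g N x)%:E @[N --> \oo] --> (h x)%:E.
  apply: cvg_EFin; first exact: nearW.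
  under eq_fun do rewrite /= gE.
  apply: cvgD; [rewrite /expR|rewrite /expR]; exact: is_cvg_series_exp_coeff.
have mh : measurable_fun setT h.
  by apply: (@measurable_fun_cvg _ _ _ _ g) => // x _; apply: fine_cvg (g_cvg x).
have ih : mu.-integrable setT (EFin \o h).
  apply/integrableP; split; first exact/measurable_EFinP.
  apply: (@le_lt_trans _ _ (4 * C)%:E); last by rewrite ltry.
  have -> : (\int[mu]_x `|(EFin \o h) x| = \int[mu]_x limn (fun N => (g N x)%:E))%E.
    apply: eq_integral => x _; rewrite (cvg_lim _ (g_cvg x)) //= ger0_norm //.
    by rewrite addr_ge0 // expR_ge0.
  have mE N : measurable_fun [set: T] (fun x => (g N x)%:E) by exact/measurable_EFinP.
  have g0 N x : setT x -> (0 <= (g N x)%:E)%E by rewrite lee_fin sumr_ge0.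
  have g_homo x : setT x -> {homo (fun N => (g N x)%:E) : N M / (N <= M)%N >-> (N <= M)%E}.
    move=> _ N M NM; rewrite lee_fin /g [leRHS](@big_cat_nat _ _ _ N) //= lerDl.
    by rewrite sumr_ge0.
  have cv := @cvg_monotone_convergence _ T R mu setT measurableT (fun N x => (g N x)%:E) mE g0 g_homo.
  rewrite -(cvg_lim _ cv) //; apply: lime_le; first by apply/cvg_ex; eexists; exact: cv.
  apply: nearW => N; have [iN leN] := ig N.
  by rewrite -[leLHS]fineK ?integrable_fin_num // lee_fin.
apply: (@integrable_le_norm _ T R mu (fun x => expR (r * `|x|)) h) => //.
  exact: measurable_expR_norm.
move=> x; rewrite ger0_norm ?expR_ge0 // /h.
have [x0|x0] := ger0P x; first by rewrite lerDl expR_ge0.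
by rewrite -mulrN lerDr expR_ge0.
Qed.

(** The disc of integrability contains two real points [r] and [- r], and
    [exp (r |x|) <= exp (r x) + exp (- r x)]. *)
Lemma integrable_expR_of_analytic (R : realType)
    (mu : {finite_measure set (measurableTypeR R) -> \bar R}) : analytic_measure mu ->
  exists2 r : R, 0 < r &
    mu.-integrable setT (fun x : measurableTypeR R => (expR (r * `|x|))%:E).
Proof.
move=> [/near_complex0P[e e0 ce] _]; pose T := measurableTypeR R.
pose r := e / 2; have r0 : 0 < r by rewrite divr_gt0.
have re s : `|s| = r -> mu.-integrable setT (fun x : T => (expR (x * s))%:E).
  move=> sr; have [|+ _] := ce s%:C; first by rewrite normc_real sr /r; lra.
  congr (mu.-integrable _ _); apply/funext => x.
  by rewrite /cexp /=; simpc; rewrite /= cos0 mulr1.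
exists r => //.
apply: (@integrable_le_norm _ T R mu _ (fun x => expR (x * r) + expR (x * - r))).
- exact: measurable_expR_norm.
- move=> x; rewrite ger0_norm ?expR_ge0 //.
  have [x0|x0] := ger0P x; first by rewrite mulrC lerDl expR_ge0.
  by rewrite mulrN mulrC mulrN lerDr expR_ge0.
- apply: (integrableD measurableT (re r _) (re (- r) _)); rewrite ?normrN gtr0_norm //.
Qed.

(** Integration of [(r |x|)^n <= n! exp (r |x|)]. *)
Lemma moment_le (R : realType)
    (mu : {finite_measure set (measurableTypeR R) -> \bar R}) (r : R) : 0 < r ->
  mu.-integrable setT (fun x : measurableTypeR R => (expR (r * `|x|))%:E) ->
  forall n, `|\int[mu]_x (x ^+ n)| <= (\int[mu]_x expR (r * `|x|)) * n`!%:R * r^-1 ^+ n.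
Proof.
move=> r0 ir n; have ix := integrable_exprn ir n r0.
have le1 (x : R) : `|x ^+ n| <= (n`!%:R * r^-1 ^+ n) * expR (r * `|x|).
  rewrite normrX mulrAC exprVn ler_pdivlMr ?exprn_gt0 //.
  by rewrite -exprMn mulrC exprn_le_expR // mulr_ge0 // ltW.
have iabs : mu.-integrable setT (fun x : measurableTypeR R => `|x ^+ n|%:E).
  have := integrable_abse ix; congr (mu.-integrable _ _).
have iz := integrableZl measurableT (n`!%:R * r^-1 ^+ n) ir.
apply: (le_trans (le_normr_Rintegral _ ix)) => //.
apply: (@le_trans _ _ (\int[mu]_x ((n`!%:R * r^-1 ^+ n) * expR (r * `|x|)))).
  by apply: le_Rintegral.
by rewrite RintegralZl // -mulrA mulrC.
Qed.

Lemma integrable_expR_le (R : realType)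
    (mu : {finite_measure set (measurableTypeR R) -> \bar R}) (r s : R) : s <= r ->
  mu.-integrable setT (fun x : measurableTypeR R => (expR (r * `|x|))%:E) ->
  mu.-integrable setT (fun x : measurableTypeR R => (expR (s * `|x|))%:E).
Proof.
move=> sr; apply: integrable_le_norm; first exact: measurable_expR_norm.
by move=> x; rewrite ger0_norm ?expR_ge0 // ler_expR ler_wpM2r.
Qed.

(** * Moment sequences are star-positive, and conversely *)

Lemma pairingD (R : realType) (tau : nat -> R[i]) (p q : {poly R[i]}) :
  pairing tau (p + q) = pairing tau p + pairing tau q.
Proof.
have sl := leq_maxl (size p) (size q); have sr := leq_maxr (size p) (size q).
rewrite (pairing_widen tau (size_polyD p q)) (pairing_widen tau sl) (pairing_widen tau sr).
by rewrite -big_split; apply: eq_bigr => i _; rewrite coefD mulrDr.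
Qed.

Lemma pairingZ (R : realType) (tau : nat -> R[i]) (c : R[i]) (p : {poly R[i]}) :
  pairing tau (c *: p) = c * pairing tau p.
Proof.
rewrite (pairing_widen tau (size_scale_leq c p)) mulr_sumr.
by apply: eq_bigr => i _; rewrite coefZ mulrCA.
Qed.

Lemma pairingXn (R : realType) (tau : nat -> R[i]) (n : nat) : pairing tau 'X^n = tau n.
Proof.
rewrite /pairing size_polyXn big_ord_recr /= coefXn eqxx mulr1 big1 ?add0r // => i _.
by rewrite coefXn ltn_eqF // mulr0.
Qed.

(** Testing on ['X^k] shows that the terms of even index are real. Testing on [1 + 'X^n] then adds
    only [tau n], with coefficient 2, so its imaginary part vanishes. *)
Lemma star_positive_real (R : realType) (tau : nat -> R[i]) (n : nat) :
  star_positive tau -> tau n = (complex.Re (tau n))%:C.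
Proof.
move=> pos.
have cX k : map_poly (@conjc R) 'X^k = 'X^k by rewrite map_polyXn.
have even k : 0 <= tau (k + k)%N.
  by have := pos 'X^k; rewrite cX -exprD pairingXn.
have := pos (1 + 'X^n); rewrite rmorphD /= rmorph1 cX.
have -> : (1 + 'X^n) * (1 + 'X^n) = 'X^0 + (2 *: 'X^n + 'X^(n + n)) :> {poly R[i]}.
  by rewrite expr0 exprD scaler_nat; ring.
rewrite !pairingD pairingZ !pairingXn.
move: (even 0%N) (even n); rewrite addn0 !lecE.
case: (tau 0%N) => a b; case: (tau n) => c d; case: (tau (n + n)%N) => e f /=.
move=> /andP[/eqP b0 _] /andP[/eqP f0 _] /andP[/eqP H _].
by congr (_ +i* _); lra.
Qed.

Lemma star_positive_moments (R : realType) (tau : nat -> R[i]) : star_positive tau ->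
  exists mu : {finite_measure set (measurableTypeR R) -> \bar R}, represents mu tau.
Proof.
move=> pos.
pose L (p : {poly R}) : R := complex.Re (pairing tau (map_poly (real_complex R) p)).
have [| | |mu muL] := @hamburger_measure R L.
- by move=> p q; rewrite /L rmorphD /= pairingD; case: (pairing _ _) => ? ?; case: (pairing _ _).
- move=> c p; rewrite /L map_polyZ pairingZ /=; case: (pairing _ _) => a b /=.
  by rewrite mul0r subr0.
- move=> p /nonneg_poly_sqr_norm[f pf]; have := pos f; rewrite -pf lecE /L.
  by case/andP.
exists mu => n; have [i1 e1] := muL 'X^n.
have hX : (@horner R 'X^n) = fun x => x ^+ n by apply/funext => x; rewrite hornerXn.
split; first by move: i1; rewrite hX.
rewrite (star_positive_real n pos); congr (_%:C).
by move: e1; rewrite hX /L map_polyXn pairingXn => ->.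
Qed.

(** For [f = a + i b] with real [a] and [b], the product of [f] and its conjugate is
    [a ^+ 2 + b ^+ 2], and its pairing is the integral of this nonnegative polynomial. *)
Lemma represents_star_positive (R : realType) (tau : nat -> R[i])
    (mu : {finite_measure set (measurableTypeR R) -> \bar R}) :
  represents mu tau -> star_positive tau.
Proof.
move=> rep f.
pose a := map_poly (@complex.Re R) f; pose b := map_poly (@complex.Im R) f.
pose p := a ^+ 2 + b ^+ 2.
have fE : f = map_poly (real_complex R) a + 'i *: map_poly (real_complex R) b.
  by apply/polyP => n; rewrite coefD coefZ !coef_map [LHS]complexE.
have fcE : map_poly (@conjc R) f =
    map_poly (real_complex R) a - 'i *: map_poly (real_complex R) b.
  apply/polyP => n; rewrite coefB coefZ !coef_map /=.
  by case: (f`_n) => u v; simpc.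
have -> : f * map_poly (@conjc R) f = map_poly (real_complex R) p.
  rewrite fcE {1}fE /p rmorphD !rmorphXn /=; set u := map_poly _ a; set v := map_poly _ b.
  have -> : (u + 'i *: v) * (u - 'i *: v) = u ^+ 2 - 'i ^+ 2 *: v ^+ 2.
    by rewrite -!mul_polyC rmorphXn /=; ring.
  by rewrite sqr_i scaleN1r opprK.
have ix n : mu.-integrable setT (fun x : measurableTypeR R => (x ^+ n)%:E) := (rep n).1.
have [ip eqp] := Rintegral_sum_exprn (fun n => p`_n) (size p) ix.
have -> : pairing tau (map_poly (real_complex R) p) = (\int[mu]_x p.[x])%:C.
  under eq_Rintegral => x _ do rewrite horner_coef -(big_mkord xpredT (fun i => p`_i * x ^+ i)).
  rewrite eqp /pairing size_map_poly big_mkord rmorph_sum; apply: eq_bigr => i _.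
  by rewrite coef_map (rep i).2 -rmorphM mulrC.
rewrite ler0c; apply: Rintegral_ge0 => x _.
by rewrite !hornerE addr_ge0 // sqr_ge0.
Qed.

(** * Holomorphy of the Laplace transform *)

(** The mean value inequality. Applied repeatedly below, it turns [|cos| <= 1] into bounds for
    [sin x], then [cos x - 1], then [sin x - x]. *)
Lemma le_norm_subr0 (R : realType) (f df : R -> R) (M x : R) :
  (forall t : R, is_derive t 1 f (df t)) -> (forall t, `|t| <= `|x| -> `|df t| <= M) ->
  `|f x - f 0| <= M * `|x|.
Proof.
move=> fd dfM.
have cf a b : {within `[a, b], continuous f}.
  apply: derivable_within_continuous => t _.
  by have [] := fd t.
have [x0|x0] := ger0P x.
  have [c] := MVT_segment x0 (fun t _ => fd t) (cf 0 x).
  rewrite in_itv /= subr0 => /andP[c0 cx] ->.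
  rewrite normrM (ger0_norm x0) ler_wpM2r // dfM //.
  by rewrite !ger0_norm.
have [c] := MVT_segment (ltW x0) (fun t _ => fd t) (cf x 0).
rewrite in_itv /= sub0r => /andP[cx c0] e; rewrite distrC e.
rewrite normrM normrN (ltr0_norm x0) ler_wpM2r ?oppr_ge0 ?(ltW x0) // dfM //.
by rewrite (ltr0_norm x0) ler0_norm // lerN2.
Qed.

Lemma norm_sin_le (R : realType) (x : R) : `|sin x| <= `|x|.
Proof.
have := @le_norm_subr0 R sin cos 1 x (fun t => is_derive_sin t) (fun t _ => cos_max t).
by rewrite sin0 subr0 mul1r.
Qed.

Lemma norm_cosB1_le (R : realType) (x : R) : `|cos x - 1| <= x ^+ 2.
Proof.
have := @le_norm_subr0 R cos (fun t => - sin t) `|x| x (fun t => is_derive_cos t).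
rewrite cos0 -normrM -expr2 ger0_norm ?sqr_ge0 //; apply => t tx.
by rewrite normrN (le_trans (norm_sin_le t)).
Qed.

Lemma norm_sinBid_le (R : realType) (x : R) : `|sin x - x| <= x ^+ 2 * `|x|.
Proof.
have := @le_norm_subr0 R (fun t => sin t - t) (fun t => cos t - 1) (x ^+ 2) x.
rewrite sin0 !subr0; apply => t tx.
rewrite (le_trans (norm_cosB1_le t)) // -(real_normK (num_real t)) -(real_normK (num_real x)).
by rewrite lerXn2r ?nnegrE.
Qed.

Lemma norm_expRB1_le (R : realType) (x : R) : `|expR x - 1| <= `|x| * expR `|x|.
Proof.
have e1 := expR_ge1Dx x; have e2 := expR_ge1Dx (- x).
have p := expR_gt0 x.
(* This is [1 - x <= exp (- x)] multiplied by [exp x]. *)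
have e3 : (1 - x) * expR x <= 1.
  by have := expRxMexpNx_1 x; nra.
have [x0|x0] := ger0P x.
  by rewrite ger0_norm; nra.
have e4 : 1 <= expR (- x) by rewrite -expR0 ler_expR; lra.
by rewrite ler0_norm; nra.
Qed.

Lemma norm_expRB1B_le (R : realType) (x : R) :
  `|expR x - 1 - x| <= x ^+ 2 * expR `|x|.
Proof.
have e1 := expR_ge1Dx x; have e2 := expR_ge1Dx (- x).
have p := expR_gt0 x.
have e3 : (1 - x) * expR x <= 1.
  by have := expRxMexpNx_1 x; nra.
have e5 : expR x - 1 - x <= x * (expR x - 1) by lra.
rewrite ger0_norm; last lra.
apply: (le_trans e5); apply: (le_trans (ler_norm _)).
rewrite normrM -(real_normK (num_real x)) expr2 -mulrA ler_wpM2l //.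
exact: norm_expRB1_le.
Qed.

Lemma normr_Re_Im_le (R : rcfType) (z : R[i]) :
  `|complex.Re z| <= ComplexField.Normc.normc z /\ `|complex.Im z| <= ComplexField.Normc.normc z.
Proof.
case: z => a b /=; rewrite -!sqrtr_sqr; split; apply: ler_wsqrtr.
  by rewrite lerDl sqr_ge0.
by rewrite lerDr sqr_ge0.
Qed.

Lemma normc_le_Re_Im (R : rcfType) (z : R[i]) :
  ComplexField.Normc.normc z <= `|complex.Re z| + `|complex.Im z|.
Proof.
case: z => a b /=; rewrite -[leRHS]ger0_norm ?addr_ge0 // -[leRHS]sqrtr_sqr.
apply: ler_wsqrtr; rewrite sqrrD !real_normK ?num_real //.
by rewrite addrAC lerDl mulrn_wge0 // mulr_ge0.
Qed.

Lemma cexpD (R : realType) (z w : R[i]) : cexp (z + w) = cexp z * cexp w.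
Proof.
case: z => a b; case: w => c d; rewrite /cexp /=; simpc; rewrite expRD cosD sinD.
by congr (_ +i* _); ring.
Qed.

Lemma norm_Re_Im_cexp (R : realType) (z : R[i]) :
  `|complex.Re (cexp z)| <= expR (complex.Re z) /\ `|complex.Im (cexp z)| <= expR (complex.Re z).
Proof.
case: z => a b; rewrite /cexp /=; simpc; rewrite /= !normrM (ger0_norm (expR_ge0 a)).
by split; rewrite ler_piMr ?expR_ge0 ?cos_max ?sin_max.
Qed.

(** The second-order Taylor remainder of the complex exponential, bounded componentwise by splitting
    off real remainders of [expR], [cos] and [sin]. *)
Lemma norm_Re_Im_cexp_sub1 (R : realType) (w : R[i]) :
  let n := ComplexField.Normc.normc w in
  `|complex.Re (cexp w - 1 - w)| <= 2 * n ^+ 2 * expR n /\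
  `|complex.Im (cexp w - 1 - w)| <= 2 * n ^+ 2 * expR n.
Proof.
move=> n; have [an bn] := normr_Re_Im_le w; rewrite -/n in an bn.
have n2 : n ^+ 2 = complex.Re w ^+ 2 + complex.Im w ^+ 2.
  by rewrite /n; case: (w) => a b /=; rewrite sqr_sqrtr // addr_ge0 // sqr_ge0.
have n0 : 0 <= n by exact: normc_nneg.
move: n2 an bn; case: (w) => a b /=; rewrite /cexp /=; simpc => n2 an bn /=.
have ea : expR `|a| <= expR n by rewrite ler_expR.
have ea' : expR a <= expR n by rewrite ler_expR (le_trans (ler_norm _)).
have en : 1 <= expR n by rewrite -expR0 ler_expR.
have bE : `|b| <= expR n by have := expR_ge1Dx n; lra.
have a2 := sqr_ge0 a; have b2 := sqr_ge0 b.
split.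
  have -> : expR a * cos b - 1 - a = (expR a - 1 - a) + expR a * (cos b - 1) by ring.
  rewrite (le_trans (ler_normD _ _)) // normrM (ger0_norm (expR_ge0 a)).
  have h1 := norm_expRB1B_le a; have h2 := norm_cosB1_le b.
  have h3 : a ^+ 2 * expR `|a| <= a ^+ 2 * expR n by rewrite ler_wpM2l.
  have h4 : expR a * `|cos b - 1| <= expR n * b ^+ 2 by rewrite ler_pM // expR_ge0.
  nra.
have -> : expR a * sin b - b = (expR a - 1) * sin b + (sin b - b) by ring.
rewrite (le_trans (ler_normD _ _)) // normrM.
have h1 := norm_sinBid_le b; have h2 := norm_expRB1_le a; have h3 := norm_sin_le b.
have h4 : `|expR a - 1| * `|sin b| <= (`|a| * expR `|a|) * `|b| by rewrite ler_pM.
have h5 : (`|a| * expR `|a|) * `|b| <= (n * expR n) * n.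
  by rewrite !ler_pM // mulr_ge0 ?expR_ge0.
have h6 : b ^+ 2 * `|b| <= n ^+ 2 * expR n by rewrite ler_pM //; lra.
lra.
Qed.

(** * Integrals of complex-valued functions *)

Section ComplexIntegral.
Context (R : realType) (mu : {finite_measure set (measurableTypeR R) -> \bar R}).
Local Notation T := (measurableTypeR R).
Implicit Types f g : R -> R[i].

Lemma cintegrableB f g : cintegrable mu f -> cintegrable mu g ->
  cintegrable mu (fun x => f x - g x).
Proof.
move=> [f1 f2] [g1 g2]; split.
  have := integrableB measurableT f1 g1; congr (mu.-integrable _ _).
  by apply/funext => x /=; case: (f x) => ? ?; case: (g x).
have := integrableB measurableT f2 g2; congr (mu.-integrable _ _).
by apply/funext => x /=; case: (f x) => ? ?; case: (g x).
Qed.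

Lemma cintegralB f g : cintegrable mu f -> cintegrable mu g ->
  cintegral mu (fun x => f x - g x) = cintegral mu f - cintegral mu g.
Proof.
move=> [f1 f2] [g1 g2]; rewrite /cintegral.
under eq_Rintegral do rewrite raddfB /=.
under [X in _ +i* X]eq_Rintegral do rewrite raddfB /=.
by rewrite !RintegralB.
Qed.

Lemma cintegrableZ (c : R[i]) f : cintegrable mu f -> cintegrable mu (fun x => c * f x).
Proof.
move=> [f1 f2]; case: c => a b; split.
  have := integrableB measurableT (integrableZl measurableT a f1) (integrableZl measurableT b f2).
  by congr (mu.-integrable _ _); apply/funext => x /=; case: (f x).
have := integrableD measurableT (integrableZl measurableT a f2) (integrableZl measurableT b f1).
by congr (mu.-integrable _ _); apply/funext => x /=; case: (f x).
Qed.

Lemma cintegralZ (c : R[i]) f : cintegrable mu f ->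
  cintegral mu (fun x => c * f x) = c * cintegral mu f.
Proof.
move=> [f1 f2]; case: c => a b; rewrite /cintegral; simpc.
have i1 := integrableZl measurableT a f1; have i2 := integrableZl measurableT b f2.
have i3 := integrableZl measurableT a f2; have i4 := integrableZl measurableT b f1.
rewrite -!RintegralZl // -RintegralB // -RintegralD //.
congr (_ +i* _); apply: eq_Rintegral => x _; case: (f x) => u v //=.
Qed.

(** The factor 2 comes from estimating the real and imaginary parts separately. *)
Lemma normc_cintegral_le f (g : T -> R) : cintegrable mu f ->
  mu.-integrable setT (EFin \o g) ->
  (forall x, `|complex.Re (f x)| <= g x /\ `|complex.Im (f x)| <= g x) ->
  ComplexField.Normc.normc (cintegral mu f) <= 2 * \int[mu]_x g x.
Proof.
move=> [f1 f2] ig fg; apply: le_trans (normc_le_Re_Im _) _; rewrite /= mulr2n mulrDl mul1r.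
apply: lerD; apply: (le_trans (le_normr_Rintegral _ _)) => //; apply: le_Rintegral => //.
- exact: integrable_abse f1.
- by move=> x _; have [] := fg x.
- exact: integrable_abse f2.
- by move=> x _; have [] := fg x.
Qed.

End ComplexIntegral.

(** * Complex differentiability of the Laplace transform *)

Section LaplaceHolomorphic.
Context (R : realType) (mu : {finite_measure set (measurableTypeR R) -> \bar R}) (r : R).
Context (ir : mu.-integrable setT (fun x : measurableTypeR R => (expR (r * `|x|))%:E)).
Local Notation T := (measurableTypeR R).
Local Notation normc := ComplexField.Normc.normc.

Lemma cexp_real_mul (x : R) (z : R[i]) : cexp (x%:C * z) =
  (expR (x * complex.Re z) * cos (x * complex.Im z)) +i*
  (expR (x * complex.Re z) * sin (x * complex.Im z)).
Proof. by case: z => a b; rewrite /cexp; simpc. Qed.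

Lemma expR_mul_Re_le (x : R) (z : R[i]) : expR (x * complex.Re z) <= expR (normc z * `|x|).
Proof.
rewrite ler_expR (le_trans (ler_norm _)) // normrM mulrC ler_wpM2r //.
by case: (normr_Re_Im_le z).
Qed.

Lemma measurable_expR_mul (a : R) : measurable_fun [set: T] (fun x : T => expR (x * a)).
Proof. by apply: measurableT_comp => //; exact: measurable_funM. Qed.

Lemma measurable_cos_mul (a : R) : measurable_fun [set: T] (fun x : T => cos (x * a)).
Proof.
apply: (measurableT_comp (continuous_measurable_fun (@continuous_cos R))).
exact: measurable_funM.
Qed.

Lemma measurable_sin_mul (a : R) : measurable_fun [set: T] (fun x : T => sin (x * a)).
Proof.
apply: (measurableT_comp (continuous_measurable_fun (@continuous_sin R))).
exact: measurable_funM.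
Qed.

(** The integrand has modulus at most [|x|^n exp (|z| |x|)]. The case [n = 0] gives the transform,
    [n = 1] its derivative. *)
Lemma cintegrable_exprn_cexp n (z : R[i]) : normc z < r ->
  cintegrable mu (fun x => (x ^+ n)%:C * cexp (x%:C * z)).
Proof.
move=> zr; have ib := integrable_exprn_expR ir n zr.
have bound (t : R -> R) x : `|t (x * complex.Im z)| <= 1 ->
    `|x ^+ n * (expR (x * complex.Re z) * t (x * complex.Im z))| <=
    `|x| ^+ n * expR (normc z * `|x|).
  move=> t1; rewrite normrM normrX ler_wpM2l ?exprn_ge0 // normrM ger0_norm ?expR_ge0 //.
  by rewrite -[leRHS]mulr1 ler_pM ?expR_ge0 ?expR_mul_Re_le.
have mx := @measurable_exprn R n.
split.
- have -> : (fun x => (complex.Re ((x ^+ n)%:C * cexp (x%:C * z)))%:E) = EFin \o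
      (fun x => x ^+ n * (expR (x * complex.Re z) * cos (x * complex.Im z))).
    by apply/funext => x; rewrite cexp_real_mul /= mul0r subr0.
  apply: integrable_le_norm ib; last by move=> x; apply: bound; exact: cos_max.
  apply: measurable_funM => //; apply: measurable_funM.
    exact: measurable_expR_mul.
  exact: measurable_cos_mul.
- have -> : (fun x => (complex.Im ((x ^+ n)%:C * cexp (x%:C * z)))%:E) = EFin \o
      (fun x => x ^+ n * (expR (x * complex.Re z) * sin (x * complex.Im z))).
    by apply/funext => x; rewrite cexp_real_mul /= mul0r addr0.
  apply: integrable_le_norm ib; last by move=> x; apply: bound; exact: sin_max.
  apply: measurable_funM => //; apply: measurable_funM.
    exact: measurable_expR_mul.
  exact: measurable_sin_mul.
Qed.

Lemma cintegrable_cexp (z : R[i]) : normc z < r ->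
  cintegrable mu (fun x => cexp (x%:C * z)).
Proof.
move=> /(cintegrable_exprn_cexp 0).
by under eq_fun do rewrite expr0 mul1r.
Qed.

(* [laplace (z + h) - laplace z - h laplace' z] is the integral of
   [exp (x z) (exp (x h) - 1 - x h)], which is of order [|h|^2]. *)
Lemma laplace_taylor (s : R) (z h : R[i]) : normc z + normc h <= s -> s < r ->
  normc (laplace mu (z + h) - laplace mu z -
    h * cintegral mu (fun x => (x ^+ 1)%:C * cexp (x%:C * z))) <=
  8 * normc h ^+ 2 * \int[mu]_x (`|x| ^+ 2 * expR (s * `|x|)).
Proof.
move=> zhs sr.
have nz := normc_nneg z; have nh := normc_nneg h.
have zr : normc z < r by lra.
have zhr : normc (z + h) < r by rewrite (le_lt_trans (le_normcD _ _)) // (le_lt_trans zhs).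
have i1 := cintegrable_cexp zhr; have i2 := cintegrable_cexp zr.
have i3 := cintegrableZ h (cintegrable_exprn_cexp 1 zr).
have i12 := cintegrableB i1 i2.
rewrite /laplace -cintegralZ; last exact: cintegrable_exprn_cexp.
rewrite -cintegralB // -cintegralB //.
have i0 := integrable_exprn_expR ir 2 sr.
have ib := integrableZl measurableT (4 * normc h ^+ 2) i0.
apply: le_trans (normc_cintegral_le (cintegrableB i12 i3) ib _) _; last first.
  by rewrite RintegralZl //; lra.
move=> x; set w := x%:C * h; set c := cexp (x%:C * z).
have -> : cexp (x%:C * (z + h)) - c - h * ((x ^+ 1)%:C * c) = c * (cexp w - 1 - w).
  by rewrite mulrDr cexpD -/c -/w expr1 /w; ring.
have [c1 c2] := norm_Re_Im_cexp (x%:C * z); rewrite -/c in c1 c2.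
have [E1 E2] := norm_Re_Im_cexp_sub1 w.
have cz : expR (complex.Re (x%:C * z)) <= expR (normc z * `|x|).
  by have := expR_mul_Re_le x z; case: (z) => a b; simpc.
have wE : normc w = normc h * `|x| by rewrite /w ComplexField.Normc.normcM normc_real mulrC.
(* Each component of [c * (cexp w - 1 - w)] combines two real products, whence the outer 2 and the
   constant 4; [normc_cintegral_le] doubles it to 8. *)
have fin : 2 * (expR (normc z * `|x|) * (2 * normc w ^+ 2 * expR (normc w))) <=
    4 * normc h ^+ 2 * (`|x| ^+ 2 * expR (s * `|x|)).
  rewrite wE exprMn.
  have -> : 2 * (expR (normc z * `|x|) * (2 * (normc h ^+ 2 * `|x| ^+ 2) * expR (normc h * `|x|))) =
     4 * normc h ^+ 2 * (`|x| ^+ 2 * (expR (normc z * `|x|) * expR (normc h * `|x|))) by ring.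
  rewrite -expRD -mulrDl !ler_wpM2l ?exprn_ge0 ?mulr_ge0 ?sqr_ge0 //.
  by rewrite ler_expR ler_wpM2r.
have key (u v u' v' : R) : `|u| <= expR (normc z * `|x|) -> `|v| <= expR (normc z * `|x|) ->
    `|u'| <= 2 * normc w ^+ 2 * expR (normc w) -> `|v'| <= 2 * normc w ^+ 2 * expR (normc w) ->
    `|u * u'| + `|v * v'| <= 4 * normc h ^+ 2 * (`|x| ^+ 2 * expR (s * `|x|)).
  move=> *; apply: le_trans fin; rewrite mulr2n mulrDl mul1r !normrM.
  by rewrite lerD // ler_pM.
have {}c1 := le_trans c1 cz; have {}c2 := le_trans c2 cz.
move: c1 c2 E1 E2; case: c => a b; case: (cexp w - 1 - w) => p q /= a1 b1 p1 q1.
split.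
  by rewrite (le_trans (ler_normB _ _)) // key.
by rewrite (le_trans (ler_normD _ _)) // key.
Qed.

Lemma laplace_derivable (z : R[i]) : normc z < r ->
  derivable (laplace mu : R[i]^o -> R[i]^o) z 1.
Proof.
move=> zr; pose D := cintegral mu (fun x => (x ^+ 1)%:C * cexp (x%:C * z)).
(* The midpoint leaves room for [|z| + |h| <= s < r]. *)
pose s := (normc z + r) / 2; pose M := \int[mu]_x (`|x| ^+ 2 * expR (s * `|x|)).
have sr : s < r by rewrite /s; lra.
have M0 : 0 <= M.
  by apply: Rintegral_ge0 => x _; rewrite mulr_ge0 ?exprn_ge0 ?expR_ge0.
apply/cvg_ex; exists (D : R[i]^o); apply/cvgrPdist_le => e e0.
have eE : e = (complex.Re e)%:C.
  by move: e0; case: (e) => a b; rewrite ltcE /= => /andP[/eqP ->].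
have e0' : 0 < complex.Re e by rewrite -ltcR -eE.
rewrite near_withinE; apply/near_complex0P.
(* The first bound gives [|z| + |h| <= s], the second [8 M |h| <= Re e]; the [+ 1] keeps the
   denominator positive when [M = 0]. *)
exists (Num.min (s - normc z) (complex.Re e / (8 * M + 1))).
  have zs : 0 < s - normc z by rewrite /s; lra.
  by rewrite lt_min zs divr_gt0 // ltr_wpDl // mulr_ge0.
move=> h; rewrite lt_min => /andP[hs he] h0.
have h0' : 0 < normc h.
  rewrite lt_neqAle normc_nneg andbT eq_sym; apply: contra h0 => /eqP/ComplexField.Normc.eq0_normc.
  by move=> ->.
have -> : (D : R[i]^o) - h^-1 *: ((laplace mu \o shift z) (h *: 1) - laplace mu z) =
    - (h^-1 * (laplace mu (z + h) - laplace mu z - h * D)) :> R[i].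
  have -> : (laplace mu \o shift z) (h *: (1 : R[i]^o)) = laplace mu (z + h).
    by rewrite /= addrC; congr (laplace mu (_ + _)); exact: mulr1.
  by rewrite mulrBr mulKf // opprB.
have H : normc (laplace mu (z + h) - laplace mu z - h * D) <= 8 * normc h ^+ 2 * M.
  by apply: laplace_taylor sr; lra.
suff : normc (h^-1 * (laplace mu (z + h) - laplace mu z - h * D)) <= complex.Re e.
  by rewrite normrN eE -lecR.
rewrite ComplexField.Normc.normcM ComplexField.Normc.normcV ler_pdivrMl //.
apply: (le_trans H); have M1 : 0 < 8 * M + 1 by lra.
move: he; rewrite ltr_pdivlMr // => he.
have : normc h * (normc h * (8 * M)) <= normc h * complex.Re e.
  by rewrite ler_pM2l //; lra.
lra.
Qed.

Lemma analytic_of_integrable_expR : 0 < r -> analytic_measure mu.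
Proof.
move=> r0; split; apply/near_complex0P; exists r => // z zr.
  exact: cintegrable_cexp.
exact: laplace_derivable.
Qed.

End LaplaceHolomorphic.

Theorem theorem6p6 (R : realType) (tau : nat -> R[i]) :
  (analytic_moment_functional tau <-> star_positive tau /\ l2_minus tau) /\
  (analytic_moment_functional tau ->
   forall mu nu : {finite_measure set (measurableTypeR R) -> \bar R},
     analytic_measure mu -> represents mu tau ->
     analytic_measure nu -> represents nu tau ->
     forall A : set (measurableTypeR R), measurable A -> mu A = nu A).
Proof.
split; first split.
- move=> [mu [mu_an rep]]; split; first exact: represents_star_positive rep.
  have [r r0 ir] := integrable_expR_of_analytic mu_an.
  apply: (@l2_minus_of_bound _ _ (\int[mu]_x expR (r * `|x|)) r^-1).
    by rewrite invr_ge0 ltW.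
  by move=> n; rewrite (rep n).2 normc_real; exact: moment_le.
- move=> [pos /l2_minus_bound[C [K [C0 K0 tauK]]]].
  have [mu rep] := star_positive_moments pos.
  have xK n : \int[mu]_x (x ^+ n) <= C * n`!%:R * K ^+ n.
    by apply: le_trans (tauK n); rewrite (rep n).2 normc_real; exact: ler_norm.
  have [r r0 ir] := integrable_expR_of_moments C0 K0 (fun n => (rep n).1) xK.
  by exists mu; split => //; exact: analytic_of_integrable_expR ir r0.
- move=> _ mu nu mu_an mu_rep nu_an nu_rep A mA.
  have [r r0 ir] := integrable_expR_of_analytic mu_an.
  have [s s0 is_] := integrable_expR_of_analytic nu_an.
  (* The smaller exponent serves both measures. *)
  apply: (@finite_measure_determinacy _ mu nu (Num.min r s)) => //.
  + by apply: integrable_expR_le ir; rewrite ge_min lexx.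
  + by apply: integrable_expR_le is_; rewrite ge_min lexx orbT.
  + by rewrite lt_min r0.
  + by move=> n; apply: complexI; rewrite -(mu_rep n).2 -(nu_rep n).2.
Qed.
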